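(* Let $k$ be a field of characteristic zero, $n\ge 3$, and let $H=(u(x,y),u_2(x,y,x_3),u_3(x,y,x_4),\ldots,u_{n-1}(x,y,x_n),u_n(x,y))$ be a polynomial map over $k$ in the variables $x=x_1,\ y=x_2,\ x_3,\ldots,x_n$. If the Jacobian matrix $JH$ is nilpotent, then $F:=X+H=(x+u,\,y+u_2,\,x_3+u_3,\ldots,x_n+u_n)$ belongs to $E(k,n)$ (that is, $F$ is a finite composition of elementary maps; in particular $F$ is invertible).
   Context: A polynomial map is called elementary if it is of the form $(x_1,\ldots,x_{i-1},x_i+a,x_{i+1},\ldots,x_n)$ for some $i$ and some $a\in k[x_1,\ldots,x_n]$ not containing $x_i$. $E(k,n)$ denotes the subgroup of $\mathrm{Aut}_k\,k[x_1,\ldots,x_n]$ generated by the elementary maps. *)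

(* Defs.v *)
From HB Require Import structures.
From mathcomp Require Import all_boot all_order all_algebra.
From mathcomp Require Import mpoly.
Set Implicit Arguments.
Unset Strict Implicit.
Unset Printing Implicit Defensive.
Import GRing.Theory.
Local Open Scope ring_scope.

(* Indices start at 0: the variables x_1, ..., x_n are 'X_0, ..., 'X_(n.-1). *)

Definition mvars (k : nzRingType) (n : nat) (p : {mpoly k[n]}) : {set 'I_n} :=
  [set i | has (fun m : 'X_{1..n} => m i != 0%N) (msupp p)].

Definition polymap (k : nzRingType) (n : nat) := n.-tuple {mpoly k[n]}.

Definition polymap_id (k : nzRingType) (n : nat) : polymap k n :=
  [tuple 'X_i | i < n].

Definition polymap_add (k : nzRingType) (n : nat) (F G : polymap k n) :
  polymap k n := [tuple tnth F i + tnth G i | i < n].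

(* x |-> F (G x) *)
Definition polymap_comp (k : nzRingType) (n : nat) (F G : polymap k n) :
  polymap k n := [tuple tnth F i \mPo G | i < n].

Definition polymap_inverse (k : nzRingType) (n : nat) (F G : polymap k n) :=
  polymap_comp F G = polymap_id k n /\ polymap_comp G F = polymap_id k n.

Definition jacobian (k : nzRingType) (n : nat) (F : polymap k n) :
  'M[{mpoly k[n]}]_n := \matrix_(i < n, j < n) (tnth F i)^`M(j).

Definition nilpotent_mx (R : nzRingType) (n : nat) (A : 'M[R]_n) :=
  exists m : nat, A ^+ m = 0.

Definition elementary_map (k : nzRingType) (n : nat) (i : 'I_n)
    (a : {mpoly k[n]}) : polymap k n :=
  [tuple if j == i then 'X_j + a else 'X_j | j < n].

Definition elementary (k : nzRingType) (n : nat) (F : polymap k n) :=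
  exists i : 'I_n, exists2 a : {mpoly k[n]},
    i \notin mvars a & F = elementary_map i a.

(* An automorphism of k[x_1, ..., x_n] is identified with the polynomial map of
   the images of the variables.  Composition of maps is the opposite of
   composition of automorphisms, which does not affect the generated subgroup.
   All members are invertible, see [elementary_group_invertible]. *)
Inductive elementary_group (k : comNzRingType) (n : nat) : polymap k n -> Prop :=
| EG_elementary F : elementary F -> elementary_group F
| EG_id : elementary_group (polymap_id k n)
| EG_comp F G : elementary_group F -> elementary_group G ->
    elementary_group (polymap_comp F G)
| EG_inv F G : elementary_group F -> polymap_inverse F G ->
    elementary_group G.

Section ElementaryGroupTheory.
Variables (k : comNzRingType) (n : nat).
Implicit Types (p a : {mpoly k[n]}) (F G K : polymap k n).

Lemma comp_mpolyA p F G : (p \mPo F) \mPo G = p \mPo polymap_comp F G.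
Proof.
rewrite (comp_mpolyE p F) (comp_mpolyE p (polymap_comp F G)).
rewrite raddf_sum; apply: eq_bigr => m _ /=.
rewrite comp_mpolyZ rmorph_prod; congr (_ *: _).
by apply: eq_bigr => i _; rewrite rmorphXn /= tnth_mktuple.
Qed.

Lemma polymap_compA F G K :
  polymap_comp F (polymap_comp G K) = polymap_comp (polymap_comp F G) K.
Proof. by apply: eq_from_tnth => i; rewrite !tnth_mktuple comp_mpolyA. Qed.

Lemma polymap_comp1m F : polymap_comp (polymap_id k n) F = F.
Proof.
by apply: eq_from_tnth => i; rewrite !tnth_mktuple comp_mpolyXU -tnth_nth.
Qed.

Lemma polymap_compm1 F : polymap_comp F (polymap_id k n) = F.
Proof. by apply: eq_from_tnth => i; rewrite !tnth_mktuple comp_mpoly_id. Qed.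

Lemma polymap_inverse_uniq F G K :
  polymap_inverse F G -> polymap_inverse F K -> G = K.
Proof.
move=> [_ GF] [FK _].
by rewrite -(polymap_compm1 G) -FK polymap_compA GF polymap_comp1m.
Qed.

Lemma polymap_inverse_comp F F' G G' :
  polymap_inverse F F' -> polymap_inverse G G' ->
  polymap_inverse (polymap_comp F G) (polymap_comp G' F').
Proof.
move=> [h1 h2] [h3 h4]; split.
  by rewrite polymap_compA -(polymap_compA F) h3 polymap_compm1.
by rewrite polymap_compA -(polymap_compA G') h2 polymap_compm1.
Qed.

Lemma comp_mpoly_elementary (i : 'I_n) a b :
  i \notin mvars a -> a \mPo elementary_map i b = a.
Proof.
rewrite inE => /hasPn ai; rewrite comp_mpolyE [RHS]mpolyE.
apply: eq_big_seq => m /ai; rewrite negbK => /eqP mi0; congr (_ *: _).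
rewrite mpolyXE_id; apply: eq_bigr => j _; rewrite tnth_mktuple.
by case: eqP => // ->; rewrite mi0 !expr0.
Qed.

Lemma mvarsN a : mvars (- a) = mvars a.
Proof. by apply/setP => i; rewrite !inE; apply/eq_has_r => m; rewrite (perm_mem (msuppN a)). Qed.

Lemma elementary_inverse (i : 'I_n) a : i \notin mvars a ->
  polymap_inverse (elementary_map i a) (elementary_map i (- a)).
Proof.
move=> ai; have X j b : 'X_j \mPo elementary_map i b =
    if j == i then 'X_j + b else 'X_j :> {mpoly k[n]}.
  by rewrite comp_mpolyXU -tnth_nth tnth_mktuple.
split; apply: eq_from_tnth => j; rewrite !tnth_mktuple; case: eqP => [->|/eqP/negPf ji].
- by rewrite comp_mpolyD X eqxx comp_mpoly_elementary // addrNK.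
- by rewrite X ji.
- by rewrite comp_mpolyD X eqxx comp_mpolyN comp_mpoly_elementary // addrK.
- by rewrite X ji.
Qed.

Lemma elementary_group_invertible F :
  elementary_group F -> exists G, polymap_inverse F G.
Proof.
elim=> {F} [F [i [a ai ->]]||F G _ [F' FF'] _ [G' GG']|F G _ _ [FG GF]].
- by exists (elementary_map i (- a)); exact: elementary_inverse.
- by exists (polymap_id k n); split; rewrite polymap_comp1m.
- by exists (polymap_comp G' F'); exact: polymap_inverse_comp.
- by exists F.
Qed.

Lemma elementary_groupP F : elementary_group F <->
  exists s : seq (polymap k n), (forall G, G \in s -> elementary G) /\
    F = foldr (@polymap_comp k n) (polymap_id k n) s.
Proof.
split; last first.
  case=> s [+ ->]; elim: s => [|G s IH] /= sE; first exact: EG_id.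
  apply: EG_comp; first by apply/EG_elementary/sE; rewrite mem_head.
  by apply: IH => K Ks; apply: sE; rewrite in_cons Ks orbT.
pose C s := foldr (@polymap_comp k n) (polymap_id k n) s.
have C_cat s t : C (s ++ t) = polymap_comp (C s) (C t).
  elim: s => [|G s IH] /=; first by rewrite polymap_comp1m.
  by rewrite IH polymap_compA.
elim=> {F} [F eF||F G _ [s [sE ->]] _ [t [tE ->]]|F G _ [s [sE ->]]].
- by exists [:: F]; split=> [G|]; rewrite /= ?polymap_compm1 // mem_seq1 => /eqP ->.
- by exists [::].
- exists (s ++ t); split; last by rewrite -[RHS]/(C (s ++ t)) C_cat.
  by move=> K; rewrite mem_cat => /orP[/sE|/tE].
elim: s sE G => [|G s IH] sE K /= FK.
  exists [::]; split=> //=; apply: polymap_inverse_uniq FK _.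
  by split; rewrite polymap_comp1m.
have [i [a ai GE]] : elementary G by apply: sE; rewrite mem_head.
have sE' : forall L, L \in s -> elementary L.
  by move=> L Ls; apply: sE; rewrite in_cons Ls orbT.
have [S sS] : exists S, polymap_inverse (C s) S.
  apply: elementary_group_invertible; elim: (s) sE' => [|L l IHl] lE /=.
    exact: EG_id.
  apply: EG_comp; first by apply/EG_elementary/lE; rewrite mem_head.
  by apply: IHl => M Ml; apply: lE; rewrite in_cons Ml orbT.
have [t [tE St]] := IH sE' S sS.
exists (t ++ [:: elementary_map i (- a)]); split.
  move=> L; rewrite mem_cat mem_seq1 => /orP[/tE //|/eqP ->].
  by exists i, (- a); rewrite ?mvarsN.
rewrite -[RHS]/(C (t ++ _)) C_cat /= polymap_compm1; apply: polymap_inverse_uniq FK _.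
by rewrite -/(C t) -[C t]St GE; apply: polymap_inverse_comp (elementary_inverse ai) sS.
Qed.

End ElementaryGroupTheory.

(* Main.v *)
From HB Require Import structures.
Require Import Defs.
From mathcomp Require Import all_boot all_order all_algebra.
From mathcomp Require Import mpoly.
From mathcomp Require Import ring zify.
Set Implicit Arguments.
Unset Strict Implicit.
Unset Printing Implicit Defensive.
Import GRing.Theory.
Local Open Scope ring_scope.

(** Write x, y, x_2, ..., x_(n-1) for the variables and u, v_1, ..., v_(n-1) for
    the components of H, so that v_i depends on x, y and x_(i+1) only.  Let d_i be
    the derivative of v_i with respect to x_(i+1), and let M be the first i >= 1
    with d_i = 0, or the last index if there is none.  The components beyond M
    are harmless, since they only contribute a triangular map.

    Read as a weighted graph, JH has a loop at x, an edge x -> y, the chain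
    y -> x_2 -> x_3 -> ..., and edges from the chain back to x and y.  Comparing its
    characteristic polynomial with a power of t ([nilpotent_chain]) gives, with
    D f = u_x f_y - u_y f_x,
      (v_1)_y = - u_x,   d_i (v_(i+1))_y = D v_i  for 1 <= i < M,   D v_M = 0.
    It follows that (v_i)_y lies in k[x, y] for all i <= M.

    The heart of the matter is that u is a polynomial in y + b(x) for some b in
    k[x]; equivalently u_x = b' u_y ([straightening]).  There are three steps.
    - The coefficient of the highest power of y in u is a constant: otherwise
      the degrees in y, and the degrees in x of the leading coefficients, grow
      along the chain in a way which excludes D v_M = 0
      ([chain_lead_coef_const]).
    - Modulo u_y the first row of the Jacobian matrix is (u_x, 0, ..., 0), so
      nilpotency makes u_y divide a power of u_x ([dvd_diag_exp]).
    - As (u_y)_x = (u_x)_y, an irreducible polynomial cannot divide u_x with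
      positive multiplicity less than its multiplicity in u_y; hence u_y divides
      u_x ([dvdp_of_dvdp_exp]).  By the first step the quotient has degree 0 in
      y, and it is a derivative ([xderiv_eq_shift]).

    Put F = X + H.  By the relations above the square of JH annihilates the
    vector e_y on the rows up to M, so (I + JH)(I - JH) e_y = e_y there.  After
    straightening u, the vector field e_y - JH e_y can be integrated explicitly:
    there is a map N in the elementary group whose derivative with respect to y
    is (e_y - JH e_y) o N on the components up to M ([straightening_map]).  By
    the chain rule the first components of F o N depend on y only through
    the term y itself.  Thus F o N is triangular for a suitable order of the
    variables, and F = (F o N) o N^-1 belongs to the elementary group
    ([chain_map_elementary]). *)

(** * Univariate polynomials in characteristic zero *)

Lemma natrS_neq0 (R : idomainType) (char0 : [pchar R] =i pred0) j :
  j.+1%:R != 0 :> R.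
Proof. by have /pcharf0P -> := char0. Qed.

Lemma pchar0_inj (R : nzRingType) (S : nzRingType) (f : {rmorphism R -> S}) :
  injective f -> [pchar R] =i pred0 -> [pchar S] =i pred0.
Proof.
move=> f_inj char0 p; rewrite -(char0 p) !inE; congr (_ && _).
by rewrite -(rmorph_nat f) -(rmorph0 f) (inj_eq f_inj).
Qed.

Lemma mulrnS_eq0 (R : idomainType) (char0 : [pchar R] =i pred0) (a : R) j :
  a *+ j.+1 = 0 -> a = 0.
Proof.
move/eqP; rewrite -mulr_natr mulf_eq0 (negPf (natrS_neq0 char0 j)) orbF.
by move/eqP.
Qed.

Lemma size_polyM_top (R : nzRingType) (p q : {poly R}) a b :
  (size p <= a.+1)%N -> (size q <= b.+1)%N -> (size (p * q)%R <= (a + b).+1)%N.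
Proof.
move=> sp sq; rewrite (leq_trans (size_polyMleq _ _)) //.
by move: (leq_add sp sq); rewrite addSn addnS; case: (_ + _)%N.
Qed.

Lemma coefM_top (R : nzRingType) (p q : {poly R}) a b :
  (size p <= a.+1)%N -> (size q <= b.+1)%N -> (p * q)`_(a + b) = p`_a * q`_b.
Proof.
move=> sp sq.
have aab : (a < (a + b).+1)%N by rewrite ltnS leq_addr.
rewrite coefM (bigD1 (Ordinal aab)) //= addKn big1 ?addr0 // => i ia.
have {}ia : (i != a :> nat) by [].
case: (ltnP a i) => h; first by rewrite (nth_default _ (leq_trans sp h)) mul0r.
rewrite (@nth_default _ 0 q) ?mulr0 //; apply: leq_trans sq _.
by move: ia h; lia.
Qed.

Lemma size_deriv_char0 (S : idomainType) (p : {poly S}) :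
  [pchar S] =i pred0 -> size p^`() = (size p).-1.
Proof.
move=> char0S; have [sp|sp] := leqP (size p) 1.
  by rewrite (size1_polyC sp) derivC size_poly0 size_polyC; case: (_ == _).
apply/eqP; rewrite eqn_leq {1}/deriv size_poly /=.
have sp2 : (size p).-1.-1.+1 = (size p).-1 by move: sp; lia.
have lp : p`_(size p).-1 != 0.
  by rewrite -lead_coefE lead_coef_eq0 -size_poly_gt0 ltnW.
have : p^`()`_(size p).-1.-1 != 0.
  by rewrite coef_deriv sp2 -mulr_natr mulf_neq0 // -sp2 natrS_neq0.
apply: contraNT; rewrite -ltnNge => h; rewrite nth_default //.
by rewrite -ltnS sp2.
Qed.

(** Existence of irreducible factors in elimination form: stating that their
    absence forces degree 0 keeps the descent on the degree free of choice. *)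
Lemma irreducible_dvdp_elim (S : idomainType) (p : {poly S}) :
    (forall q, irreducible_poly q -> q %| p -> False) -> p != 0 ->
  (size p <= 1)%N.
Proof.
elim: {p}(size p).+1 {-2}p (ltnSn (size p)) => // m IH p; rewrite ltnS => sm H p0.
rewrite leqNgt; apply/negP => s1; apply: (H p) => //; split=> // q q1 qp.
apply/negPn/negP => nqp.
have q0 : q != 0 by apply: contraTneq qp => ->; rewrite dvd0p.
have sq : (size q < size p)%N.
  by rewrite ltn_neqAle dvdp_leq // dvdp_size_eqp // andbT.
have : (size q <= 1)%N.
  apply: IH q0; first exact: leq_trans sm.
  by move=> r r_irr rq; apply: (H r) => //; apply: dvdp_trans qp.
by rewrite leqNgt ltn_neqAle eq_sym q1 size_poly_gt0 q0.
Qed.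

Lemma irreducible_coprimep (S : idomainType) (p q : {poly S}) :
  irreducible_poly p -> ~~ (p %| q) -> coprimep p q.
Proof.
move=> p_irr; apply: contraR; rewrite coprimep_def => g1.
by rewrite -(eqp_dvdl _ (p_irr _ g1 (dvdp_gcdl p q))) dvdp_gcdr.
Qed.

Lemma irreducible_dvdp_exp (S : idomainType) (p q : {poly S}) m :
  irreducible_poly p -> p %| q ^+ m -> p %| q.
Proof.
move=> p_irr; apply: contraTT => /(irreducible_coprimep p_irr) cpq.
have := coprimep_expr m cpq; apply: contraTN => pq.
by rewrite /coprimep (eqp_size (dvdp_gcd_idl pq)) neq_ltn p_irr.1 orbT.
Qed.

(** The multiplicity of p in q.  Divisibility over a domain is divisibility over
    the field of fractions, whence the scalar t. *)
Lemma exists_multiplicity_dvdp (S : idomainType) (p q : {poly S}) :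
    (1 < size p)%N -> q != 0 -> exists c, exists2 v, ~~ (p %| v) &
  exists2 t, t != 0 & t *: q = v * p ^+ c.
Proof.
move=> sp q0; have p0 : p != 0 by rewrite -size_poly_gt0 ltnW.
pose P c := p ^+ c %| q.
have P0 : exists c, P c by exists 0; rewrite /P expr0 dvd1p.
have Pb c : P c -> (c <= size q)%N.
  move=> /(dvdp_leq q0); apply: leq_trans.
  by have := size_exp p c; move: sp; case: (size p) => [|[|d]] // _ /= e; nia.
case: (ex_maxnP P0 Pb) => c /Pdiv.Idomain.dvdpP[[t v] /= t0 e] max_c.
exists c, v; last by exists t.
apply/negP => /Pdiv.Idomain.dvdpP[[s w] /= s0 e'].
have /max_c : P c.+1.
  apply/Pdiv.Idomain.dvdpP; exists (s * t, w); rewrite /= ?mulf_neq0 //.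
  by rewrite -scalerA e scalerAl e' exprS mulrA.
by rewrite ltnn.
Qed.

(** * Polynomials in two variables *)

Section TwoVariables.
Variables (R : idomainType) (char0 : [pchar R] =i pred0).
Implicit Types p q : {poly {poly R}}.

(** The outer variable is y, with derivative [p^`()], and the variable of the
    coefficients is x, with derivative [xderiv p]. *)
Definition xderiv p := map_poly (@deriv R) p.

Lemma xderivD p q : xderiv (p + q) = xderiv p + xderiv q.
Proof. exact: raddfD. Qed.

Lemma xderivM p q : xderiv (p * q) = xderiv p * q + p * xderiv q.
Proof.
apply/polyP => i; rewrite coefD coef_map /= !coefM raddf_sum -big_split /=.
by apply: eq_bigr => j _; rewrite derivM !coef_map.
Qed.

Lemma xderivC (c : {poly R}) : xderiv c%:P = c^`()%:P.
Proof. exact: map_polyC. Qed.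

Lemma xderivX p j : xderiv (p ^+ j.+1) = j.+1%:R * (p ^+ j * xderiv p).
Proof.
elim: j => [|j IH]; first by rewrite !expr1 expr0 !mul1r.
by rewrite exprS xderivM IH -[j.+2%:R]natr1 !exprS; ring.
Qed.

Lemma char0_poly : [pchar {poly R}] =i pred0.
Proof. exact: pchar0_inj (@polyC_inj R) char0. Qed.

(** Let pi be an irreducible factor of A / gcd(A, B).  It divides B, hence also
    g := gcd(A, B), say with multiplicity c >= 1, and then exactly with
    multiplicity c in B and with a larger one in A.  So pi^c divides the
    x-derivative of A, while the y-derivative of B has multiplicity c - 1 only,
    because pi does not divide its own derivative: the degree drops and the
    characteristic is zero. *)
Lemma dvdp_of_dvdp_exp (A B : {poly {poly R}}) m :
  A != 0 -> xderiv A = B^`() -> A %| B ^+ m -> A %| B.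
Proof.
move=> A0 AB dAB; pose g := gcdp A B.
have gA : g %| A by apply: dvdp_gcdl.
have gB : g %| B by apply: dvdp_gcdr.
have g0 : g != 0 by rewrite gcdp_eq0 negb_and A0.
have cab : coprimep (A %/ g) (B %/ g) by rewrite coprimep_div_gcd ?A0.
move: (Pdiv.Idomain.divpK gA) (Pdiv.Idomain.divpK gB) cab.
set a := A %/ g; set b := B %/ g.
set s1 := _ ^+ scalp A g; set s2 := _ ^+ scalp B g => eA eB cab.
have s10 : s1 != 0 by rewrite expf_neq0 ?lead_coef_eq0.
have s20 : s2 != 0 by rewrite expf_neq0 ?lead_coef_eq0.
have a0 : a != 0.
  by apply: contra_eqN eA => /eqP ->; rewrite mul0r eq_sym scale_poly_eq0 negb_or s10.
(* If a is constant then A is g up to scalars, and g divides B. *)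
suff sa : (size a <= 1)%N.
  have a1 : a`_0 != 0 by move: a0; rewrite {1}(size1_polyC sa) polyC_eq0.
  apply: dvdp_trans gB; rewrite -(dvdpZl _ _ s10) -eA (size1_polyC sa).
  by rewrite mul_polyC dvdpZl.
apply: irreducible_dvdp_elim a0 => pi pi_irr pi_a.
have [||c [v piv [t t0 eg]]] := @exists_multiplicity_dvdp _ pi g => //.
  by rewrite pi_irr.1.
have piA : pi %| A by rewrite -(dvdpZr _ _ s10) -eA dvdp_mulr.
have piB : pi %| B by apply: irreducible_dvdp_exp pi_irr (dvdp_trans piA dAB).
have pib : coprimep pi b by apply: coprimep_dvdr cab.
have pig : pi %| g by rewrite dvdp_gcd piA.
have [c1 ec] : exists c1, c = c1.+1.
  case: c eg => [|c1] eg; last by exists c1.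
  by case/negP: piv; rewrite -[v]mulr1 -(expr0 pi) -eg dvdpZr.
rewrite {}ec in eg.
have /Pdiv.Idomain.dvdpP[[s3 a'] /= s30 ea] := pi_a.
pose sg := s3 * (s1 * t); pose rh := s2 * t.
have sg0 : sg != 0 by rewrite !mulf_neq0.
have rh0 : rh != 0 by rewrite mulf_neq0.
have eA' : sg%:P * A = (a' * v) * pi ^+ c1.+2.
  rewrite -!mul_polyC in eA ea eg.
  have -> : sg%:P * A = s3%:P * t%:P * (s1%:P * A) by rewrite /sg !polyCM; ring.
  rewrite -eA.
  have -> : s3%:P * t%:P * (a * g) = (s3%:P * a) * (t%:P * g) by ring.
  by rewrite ea eg !exprS; ring.
have eB' : rh%:P * B = (b * v) * pi ^+ c1.+1.
  rewrite -!mul_polyC in eB eg.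
  have -> : rh%:P * B = t%:P * (s2%:P * B) by rewrite /rh !polyCM; ring.
  by rewrite -eB mulrCA eg mulrA.
clearbody sg rh.
(* The x-derivative of A, cleared of the scalar sg, still has pi^(c1 + 1). *)
pose Q := sg%:P * (xderiv (a' * v) * pi + c1.+2%:R * (a' * v * xderiv pi))
  - sg^`()%:P * (a' * v * pi).
have eA2 : sg%:P ^+ 2 * xderiv A = Q * pi ^+ c1.+1.
  move/(congr1 xderiv): (eA'); rewrite 2!xderivM xderivC xderivX => e.
  have -> : sg%:P ^+ 2 * xderiv A = sg%:P * (sg^`()%:P * A + sg%:P * xderiv A)
     - sg^`()%:P * (sg%:P * A) by ring.
  by rewrite e eA' /Q exprS; ring.
have eB2 : rh%:P * B^`() =
    ((b * v)^`() * pi + c1.+1%:R * (b * v * pi^`())) * pi ^+ c1.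
  have := congr1 (@deriv _) eB'; rewrite 2!derivM derivC mul0r add0r => ->.
  by rewrite deriv_exp /= -mulr_natr exprS; ring.
have pi0 : pi != 0 by apply: irredp_neq0.
have : pi %| (sg ^+ 2)%:P * (c1.+1%:R * (b * v * pi^`())).
  rewrite -(dvdp_mul2r _ _ (expf_neq0 c1 pi0)) -exprS.
  have -> : (sg ^+ 2)%:P * (c1.+1%:R * (b * v * pi^`())) * pi ^+ c1 =
     rh%:P * Q * pi ^+ c1.+1 - (sg ^+ 2)%:P * (b * v)^`() * pi ^+ c1.+1.
    rewrite -[rh%:P * Q * _]mulrA -eA2 AB !rmorphXn /=.
    rewrite [rh%:P * _]mulrCA eB2 [pi ^+ c1.+1]exprS; ring.
  by rewrite -mulrBl dvdp_mull.
rewrite mul_polyC dvdpZr ?expf_neq0 // -polyC_natr mul_polyC dvdpZr; last first.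
  exact: natrS_neq0 char0_poly _.
rewrite -mulrA Gauss_dvdpr // Gauss_dvdpr ?irreducible_coprimep //.
move/dvdp_leq; rewrite size_deriv_char0 //; last exact: char0_poly.
have sp := pi_irr.1.
rewrite -size_poly_gt0 size_deriv_char0; last exact: char0_poly.
by move: sp; case: (size pi) => [|[|d]] // _ /(_ isT); rewrite ltnn.
Qed.

(** The Euler operator X d/dX preserves degrees and multiplies the coefficient of
    degree j by j, so leading coefficients can be compared without
    shifting indices. *)
Lemma coef_mulX_deriv (S : idomainType) (p : {poly S}) j :
  ('X * p^`())`_j = p`_j *+ j.
Proof. by rewrite coefXM coef_deriv; case: j. Qed.

Lemma size_mulX_deriv (S : idomainType) (p : {poly S}) j :
  (size p <= j)%N -> (size ('X * p^`())%R <= j)%N.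
Proof.
move=> sp; apply/leq_sizeP => i ji; rewrite coef_mulX_deriv nth_default ?mul0rn //.
exact: leq_trans ji.
Qed.

(** If C and w have degrees e and f, the coefficient of degree e + f - 1 in T is
    g e - d f times the product of their leading coefficients. *)
Lemma wronskian_neq0 (C w : {poly R}) g d :
    w != 0 -> (d * (size w).-1 < g * (size C).-1)%N ->
  let T := (C^`() * w) *+ g - (C * w^`()) *+ d in
  T != 0 /\ (size T <= (size C).-1 + (size w).-1)%N.
Proof.
move=> w0 cmp T; set e := (size C).-1; set f := (size w).-1.
have sC : size C = e.+1.
  by move: cmp; rewrite /e; case: (size C) => [|[|j]] //=; rewrite muln0.
have sw : size w = f.+1 by move: w0; rewrite -size_poly_gt0 /f; case: (size w).
have XT : 'X * T = (('X * C^`()) * w) *+ g - (C * ('X * w^`())) *+ d.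
  by rewrite /T mulrBr !mulrnAr ['X * (C * _)]mulrCA !mulrA.
have top : ('X * T)`_(e + f) != 0.
  rewrite XT coefB !coefMn !coefM_top ?size_mulX_deriv ?sC ?sw //.
  rewrite !coef_mulX_deriv mulrnAl mulrnAr -!mulrnA mulnC [(f * d)%N]mulnC.
  rewrite -mulrnBr ?(ltnW cmp) // -mulr_natr mulf_neq0 //.
    have sC0 : C != 0 by rewrite -size_poly_gt0 sC.
    by apply: mulf_neq0; rewrite -lead_coefE lead_coef_eq0.
  by move: cmp; rewrite -subn_gt0; case: (_ - _)%N => // j _; apply: natrS_neq0.
have T0 : T != 0 by apply: contraNneq top => ->; rewrite mulr0 coef0.
split=> //; rewrite -ltnS -(size_mulX T0) mulrC XT.
rewrite (leq_trans (size_polyD _ _)) // geq_max size_polyN.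
rewrite -!scaler_nat.
by rewrite !(leq_trans (size_scale_leq _ _)) // size_polyM_top ?size_mulX_deriv ?sC ?sw.
Qed.

(** Let C be the coefficient of y^d in U, where d is the degree in y, and let
    C have degree e > 0.  Inductively V_i' has degree i d in y, and its leading
    coefficient w_i is nonzero of degree at most i (e - 1) in x: the coefficient
    of y^((i + 1) d) in the right-hand side, times g := i d + 1, is the
    expression g C' w_i - d C w_i' of the previous lemma, and
    g e - d i (e - 1) = e + i d > 0.  Dividing by D i can only lower the degree
    in x.  The same coefficient contradicts the last equation. *)
Lemma chain_lead_coef_const (U : {poly {poly R}}) (V : nat -> {poly {poly R}})
    (D : nat -> {poly R}) M :
    (1 < size U)%N -> (0 < M)%N -> (V 1)^`() = - xderiv U ->
    (forall i, (0 < i < M)%N -> D i != 0 /\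
      (D i)%:P * (V i.+1)^`() = xderiv U * (V i)^`() - U^`() * xderiv (V i)) ->
    xderiv U * (V M)^`() - U^`() * xderiv (V M) = 0 ->
  (lead_coef U)^`() = 0.
Proof.
move=> sU M0 V1 VS VM; apply/eqP; apply: contraT => C'0.
set C := lead_coef U in C'0 *.
have [d sUd] : exists d, size U = d.+2.
  by move: sU; case: (size U) => [|[|d]] // _; exists d.
have CE : C = U`_d.+1 by rewrite /C lead_coefE sUd.
set e := (size C).-1.
have e0 : (0 < e)%N.
  rewrite /e ltnNge; apply: contra C'0 => e_le0.
  have /size1_polyC -> : (size C <= 1)%N by move: e_le0; case: (size C) => [|[]].
  by rewrite derivC.
pose w i := (V i)^`()`_(i * d.+1).
pose inv i := [/\ (size (V i)^`()%R <= (i * d.+1).+1)%N, w i != 0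
  & (size (w i) <= (i * e.-1).+1)%N].
have sx p : (size (xderiv p) <= size p)%N by apply: size_poly.
have key i : inv i -> let Z := xderiv U * (V i)^`() - U^`() * xderiv (V i) in
  [/\ (size Z <= (i.+1 * d.+1).+1)%N, Z`_(i.+1 * d.+1) != 0
    & (size (Z`_(i.+1 * d.+1))%R <= (i.+1 * e.-1).+1)%N].
  case=> [s1 w0 sw] Z; set g := (i * d.+1).+1 in s1 *.
  have sV : (size (V i) <= g.+1)%N.
    by move: s1; rewrite size_deriv_char0; [case: (size (V i)) | exact: char0_poly].
  have sU' : (size U^`()%R <= d.+1)%N.
    by rewrite size_deriv_char0 ?sUd //; exact: char0_poly.
  have sxU : (size (xderiv U) <= d.+2)%N by rewrite -sUd.
  have sxV : (size (xderiv (V i)) <= g.+1)%N := leq_trans (sx _) sV.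
  have dg : (i.+1 * d.+1 = d + g)%N by rewrite /g; lia.
  have sZ : (size Z <= (i.+1 * d.+1).+1)%N.
    rewrite (leq_trans (size_polyD _ _)) // geq_max size_polyN.
    by rewrite [X in (_ <= X.+1)%N && _]mulSn size_polyM_top // dg size_polyM_top.
  have ZE : Z`_(i.+1 * d.+1) *+ g = (C^`() * w i) *+ g - (C * (w i)^`()) *+ d.+1.
    rewrite /Z coefB mulrnBl; congr (_ - _).
      by rewrite mulSn coefM_top // coef_map -CE.
    have -> : w i = (V i)`_g *+ g by rewrite /w coef_deriv.
    rewrite dg coefM_top // coef_deriv coef_map /= -CE derivMn mulrnAl mulrnAr.
    by rewrite -!mulrnA mulnC.
  have [|T0 sT] := @wronskian_neq0 C (w i) g d.+1 w0.
    by rewrite -/e /g; nia.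
  have Z0 : Z`_(i.+1 * d.+1) != 0.
    by apply: contraNneq T0 => z0; rewrite -ZE z0 mul0rn.
  split=> //; rewrite -ZE in sT.
  have : (size (Z`_(i.+1 * d.+1))%R <= size (Z`_(i.+1 * d.+1) *+ g)%R)%N.
    by rewrite -scaler_nat size_scale // natrS_neq0.
  by move/leq_trans/(_ sT); rewrite -/e; nia.
have inv1 : inv 1.
  rewrite /inv /w V1 !mul1n size_polyN coefN oppr_eq0 size_polyN coef_map /=.
  rewrite -CE -sUd; split=> //; rewrite size_deriv_char0 // -/e; lia.
have invS i : (0 < i <= M)%N -> inv i.
  elim: i => // i IH; rewrite ltnS /= => iM; case: (posnP i) => [->//|i0].
  have /key[sZ Z0 sz] : inv i by apply: IH; rewrite i0 ltnW.
  have [|D0 eD] := VS i; first by rewrite i0.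
  have eD' : (V i.+1)^`()`_(i.+1 * d.+1) * D i =
      (xderiv U * (V i)^`() - U^`() * xderiv (V i))`_(i.+1 * d.+1).
    by rewrite -eD coefCM mulrC.
  rewrite -eD mul_polyC size_scale // in sZ.
  rewrite /inv /w; split=> //.
    by apply: contraNneq Z0 => v0; rewrite -eD' v0 mul0r.
  apply: leq_trans sz; rewrite -eD'.
  have [->|v0] := eqVneq ((V i.+1)^`()`_(i.+1 * d.+1)) 0; first by rewrite size_poly0.
  by rewrite size_mul //; move: D0; rewrite -size_poly_gt0; lia.
have /key[] : inv M by apply: invS; rewrite M0 leqnn.
by rewrite VM coef0 eqxx.
Qed.
End TwoVariables.

(** The quotient of the x-derivative by the y-derivative of U = C y^d + c y^(d-1) + ...
    has degree 0 in y since C is constant; comparing coefficients of y^(d-1)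
    identifies it as c' / (d C). *)
Lemma xderiv_eq_shift (K : fieldType) (char0 : [pchar K] =i pred0)
    (U : {poly {poly K}}) m :
    (lead_coef U)^`() = 0 -> U^`() %| xderiv U ^+ m ->
  exists b : {poly K}, xderiv U = b^`()%:P * U^`().
Proof.
move=> lead' dvdU; have char0K := char0_poly char0.
have [sU|sU] := leqP (size U) 1.
  exists 0; rewrite deriv0 polyC0 mul0r.
  by move: lead'; rewrite (size1_polyC sU) lead_coefC xderivC => ->; rewrite polyC0.
have [d sUd] : exists d, size U = d.+2.
  by move: sU; case: (size U) => [|[|d]] // _; exists d.
have CE : lead_coef U = U`_d.+1 by rewrite lead_coefE sUd.
have sU' : size U^`() = d.+1 by rewrite size_deriv_char0 ?sUd.
have U'0 : U^`() != 0 by rewrite -size_poly_gt0 sU'.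
have : U^`() %| xderiv U.
  apply: dvdp_of_dvdp_exp dvdU => //.
  by apply/polyP => i; rewrite !(coef_map, coef_deriv) /= derivMn.
case/Pdiv.Idomain.dvdpP => [[s Q] /= s0 eQ].
have sxU : (size (xderiv U) <= d.+1)%N.
  apply/leq_sizeP => j; rewrite leq_eqVlt => /orP[/eqP <-|dj].
    by rewrite coef_map /= -CE lead'.
  by rewrite coef_map /= nth_default ?sUd // deriv0.
have sQ : (size Q <= 1)%N.
  have [->|Q0] := eqVneq Q 0; first by rewrite size_poly0.
  move: (size_mul Q0 U'0); rewrite -eQ size_scale // sU' addnS /= => e.
  by move: sxU; rewrite e -[d.+1]add1n leq_add2r.
have [c lc] : exists c : K, lead_coef U = c%:P.
  exists (lead_coef U)`_0; apply: size1_polyC.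
  move: (size_deriv_char0 (lead_coef U) char0); rewrite lead' size_poly0.
  by case: (size _) => [|[]].
have c0 : c *+ d.+1 != 0.
  apply/eqP => /(mulrnS_eq0 char0) c0; move: lc; rewrite c0 => /eqP.
  by rewrite polyC0 lead_coef_eq0 -size_poly_eq0 sUd.
(* No antiderivative has to be taken: this b is already a multiple of a
   coefficient of U. *)
exists ((c *+ d.+1)^-1 *: U`_d).
apply: (@mulfI _ s%:P); first by rewrite polyC_eq0.
rewrite [LHS]mul_polyC eQ mulrA -polyCM; congr (_ * _); rewrite (size1_polyC sQ).
congr (_%:P); have := congr1 (fun p : {poly _} => p`_d) eQ => /=.
rewrite coefZ coef_map /= {1}(size1_polyC sQ) coefCM coef_deriv -CE lc => e.
by rewrite derivZ -scalerAr e -mul_polyC mulrC -mulrA -polyCMn -polyCM divff // mulr1.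
Qed.

(** * Nilpotent matrices of chain shape *)

(** J is the Jacobian matrix of a chain map: a and c are its first two columns, and
    beyond them row i has at most the entry d i in column i + 1. *)
Section NilpotentShape.
Variables (R : idomainType) (n : nat) (J : 'M[R]_n.+2).
Hypothesis J_shape : forall i j : 'I_n.+2, (1 < j)%N -> i.+1 != j -> J i j = 0.
Variable m : nat.
Hypothesis J_nil : J ^+ m = 0.

Let a i := J (inord i) ord0.
Let c i := J (inord i) (inord 1).
Let d i := J (inord i) (inord i.+1).
Let P i := \prod_(1 <= j < i) d j.

Lemma row0E : row ord0 J = a 0 *: delta_mx ord0 ord0 + c 0 *: delta_mx ord0 (inord 1).
Proof.
have i0 : inord 0 = ord0 :> 'I_n.+2 by apply: val_inj; exact: inordK.
have i1 : (inord 1 : 'I_n.+2) = 1%N :> nat by rewrite inordK.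
apply/rowP => j; rewrite !mxE /= /a /c i0 -!val_eqE /= i1.
case: j => [[|[|j]] lj] /=; rewrite ?mulr1 ?mulr0 ?addr0 ?add0r //.
- by congr (J _ _); apply: val_inj.
- by congr (J _ _); apply: val_inj; rewrite /= i1.
- by rewrite J_shape.
Qed.

(** Modulo c 0 the first row of J is a 0 times the first unit vector, so the same
    holds for the powers of J. *)
Lemma dvd_diag_exp : exists Q, a 0 ^+ m = c 0 * Q.
Proof.
suff H l : exists v : 'rV_n.+2,
    row ord0 (J ^+ l) = a 0 ^+ l *: delta_mx ord0 ord0 + c 0 *: v.
  have [v /rowP/(_ ord0)] := H m; rewrite J_nil !mxE /= mulr1 => e.
  by exists (- v ord0 ord0); rewrite mulrN; apply/eqP; rewrite -addr_eq0 -e.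
elim: l => [|l [v IH]].
  exists 0; rewrite !expr0 scaler0 addr0 scale1r.
  by apply/rowP => j; rewrite !mxE eq_sym.
exists (a 0 ^+ l *: delta_mx ord0 (inord 1) + v *m J).
rewrite exprSr row_mul IH mulmxDl -!scalemxAl -rowE row0E !scalerDr !scalerA.
by rewrite exprSr addrA [c 0 * _]mulrC.
Qed.

Let alpha := \poly_(j < n.+1) (P (n.+1 - j) * a (n.+1 - j)).
Let gamma := \poly_(j < n.+1) (P (n.+1 - j) * c (n.+1 - j)).
Let chi := ('X - (a 0)%:P) * ('X^(n.+1) - gamma) - (c 0)%:P * alpha.

Let A : 'M[{poly R}]_n.+2 := 'X%:M - map_mx polyC J.

(** The entries from the third on of [rho r s *m A] vanish, by the choice of the
    weights P i X^(n + 1 - i); what remains is a system of size 2 in (r, s) with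
    determinant [chi], the characteristic polynomial of J. *)
Let rho (r s : {poly R}) : 'rV_n.+2 :=
  \row_i if i == ord0 then r else s * ((P i)%:P * 'X^(n.+1 - i)).

Lemma rho_sum (r s : {poly R}) (f : nat -> R) :
  \sum_(i < n.+2) rho r s ord0 i * (f i)%:P =
  r * (f 0)%:P + s * \poly_(j < n.+1) (P (n.+1 - j) * f (n.+1 - j)%N).
Proof.
rewrite big_ord_recl mxE eqxx; congr (_ + _).
rewrite poly_def mulr_sumr (reindex_inj rev_ord_inj) /=.
apply: eq_bigr => i _; rewrite mxE /= -mul_polyC polyCM /bump /=.
have lin := ltn_ord i.
have -> : (n.+1 - (1 + (n.+1 - i.+1)) = i)%N by lia.
have -> : (1 + (n.+1 - i.+1) = n.+1 - i)%N by lia.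
by ring.
Qed.

Lemma rhoM (r s : {poly R}) (j : 'I_n.+2) :
  (rho r s *m A) ord0 j =
  'X * rho r s ord0 j - \sum_(i < n.+2) rho r s ord0 i * (J i j)%:P.
Proof.
rewrite mulmxBr mul_mx_scalar !mxE; congr (_ - _).
by apply: eq_bigr => i _; rewrite !mxE.
Qed.

Lemma rhoA (r s : {poly R}) : rho r s *m A =
  (('X - (a 0)%:P) * r - s * alpha) *: delta_mx ord0 ord0
  + (s * ('X^(n.+1) - gamma) - (c 0)%:P * r) *: delta_mx ord0 (inord 1).
Proof.
have i1 : (inord 1 : 'I_n.+2) = 1%N :> nat by rewrite inordK.
have iE (i : 'I_n.+2) : J i =1 J (inord i) by move=> j; rewrite inord_val.
apply/rowP => j; rewrite rhoM !mxE /= -!val_eqE /= i1.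
have [j0|j1|j2] := ltngtP j 1.
- have -> : j = ord0 by apply: val_inj; case: j j0 => [[|j] lj].
  under eq_bigr do rewrite iE; rewrite (rho_sum r s a) /= mulr1 mulr0 addr0.
  by rewrite /alpha; ring.
- case: j j1 => [[|[|j]] lj] // _ /=.
  have lj1 : (j.+1 < n.+2)%N by rewrite ltnW.
  rewrite (bigD1 (Ordinal lj1)) //= big1 => [|i ij]; last first.
    by rewrite J_shape ?mulr0 //; apply: contra ij => /eqP[ij]; apply/eqP/val_inj.
  rewrite !mxE /= !mulr0 !addr0 /P [\prod_(_ <= _ < j.+2) _]big_nat_recr //=.
  rewrite -/(P j.+1) /d.
  have -> : inord j.+1 = Ordinal lj1 by apply: val_inj; rewrite /= inordK.
  have -> : inord j.+2 = Ordinal lj by apply: val_inj; rewrite /= inordK.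
  have -> : (n.+1 - j.+1 = (n.+1 - j.+2).+1)%N by move: lj; lia.
  by rewrite polyCM exprS; ring.
- have -> : j = inord 1 by apply: val_inj; rewrite /= i1.
  under eq_bigr do rewrite iE; rewrite (rho_sum r s c) /= i1 /= mulr1 mulr0 add0r.
  rewrite {1}/P big_geq // subSS subn0 polyC1 exprS -/gamma.
  by ring.
Qed.

Lemma chi_monic : chi \is monic /\ size chi = n.+3.
Proof.
have sg : (size gamma < size ('X^(n.+1) : {poly R}))%N.
  by rewrite size_polyXn ltnS size_poly.
have mg : 'X^(n.+1) - gamma \is monic.
  by rewrite monicE lead_coefDl ?size_polyN // lead_coefXn.
have s1 : size (('X - (a 0)%:P) * ('X^(n.+1) - gamma)) = n.+3.
  rewrite size_monicM ?monicXsubC ?monic_neq0 // size_XsubC size_polyDl ?size_polyN //.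
  by rewrite size_polyXn.
have s2 : (size (- ((c 0)%:P * alpha)) <
    size (('X - (a 0)%:P) * ('X^(n.+1) - gamma))%R)%N.
  rewrite s1 size_polyN mul_polyC (leq_ltn_trans (size_scale_leq _ _)) //.
  by rewrite (leq_ltn_trans (size_poly _ _)).
split; last by rewrite size_polyDl.
by rewrite monicE lead_coefDl // -monicE monicMl ?monicXsubC.
Qed.

(** As J is nilpotent, A has an inverse up to a power of X.  Hence, whenever
    [rho r s *m A] is chi times a unit vector, chi divides s times a power of X.
    For c 0 != 0 this applies to s = c 0; for c 0 = 0 also a 0 = 0, and it
    applies to s = X.  A monic divisor of a power of X is a power of X. *)
Lemma chiE : chi = 'X^(n.+2).
Proof.
have [chi_m chi_s] := chi_monic.
(* The geometric sum for X^m - J^m, where J^m = 0. *)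
pose N := \sum_(i < m) ('X%:M ^+ (m.-1 - i)) * map_mx polyC J ^+ i : 'M[{poly R}]_n.+2.
have AN : A *m N = 'X^m%:M.
  have comX : GRing.comm ('X%:M : 'M[{poly R}]_n.+2) (map_mx polyC J).
    by rewrite /GRing.comm -!mulmxE mul_scalar_mx mul_mx_scalar.
  have Jm : (map_mx polyC J : 'M_n.+2) ^+ m = 0 by rewrite -rmorphXn /= J_nil map_mx0.
  have := subrXX_comm m comX; rewrite Jm subr0 -rmorphXn /= => ->.
  rewrite mulmxE /A /N; congr (_ * _); apply: eq_bigr => i _; congr (_ ^+ _ * _); lia.
have dvd s r t j : rho r s *m A = (t * chi) *: delta_mx ord0 j ->
    chi %| s * 'X^(n + m).
  move=> /(congr1 (fun B => (B *m N) ord0 (inord 1))).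
  rewrite -mulmxA AN mul_mx_scalar -scalemxAl !mxE -val_eqE /= inordK //=.
  rewrite /P big_geq // mul1r subSS subn0 mulrCA -exprD [(m + n)%N]addnC => ->.
  by rewrite -mulrA mulrCA dvdp_mulIl.
have chi_dvd : chi %| 'X^((n + m).+1).
  have [c0|c0] := eqVneq (c 0) 0.
    have [Q] := dvd_diag_exp; rewrite c0 mul0r => /eqP.
    rewrite expf_eq0 => /andP[_ /eqP a0].
    rewrite exprS; apply: (dvd _ alpha 1 (inord 1)).
    rewrite rhoA /chi a0 c0 subr0 (_ : _ - _ = 0); last by ring.
    by rewrite scale0r add0r mul1r.
  rewrite exprS dvdp_mull //.
  rewrite -(dvdpZr _ _ c0) -mul_polyC; apply: (dvd _ ('X^(n.+1) - gamma) 1 ord0).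
  rewrite rhoA [X in _ + X *: _](_ : _ = 0) ?scale0r ?addr0 ?mul1r //; ring.
have := chi_dvd; rewrite -['X in X in _ %| X]subr0 => /dvdp_exp_XsubCP[k _].
rewrite subr0 eqp_monic ?monicXn // => /eqP chik.
by move: chi_s; rewrite chik size_polyXn => -[->].
Qed.

Lemma nilpotent_chain :
  [/\ a 0 + c 1 = 0,
      forall i, (0 < i <= n)%N -> P i.+1 * c i.+1 = P i * (a 0 * c i - c 0 * a i)
    & P n.+1 * (a 0 * c n.+1 - c 0 * a n.+1) = 0].
Proof.
have coefE i : (i < n.+2)%N -> chi`_i = 0.
  by move=> lt; rewrite chiE coefXn ltn_eqF.
have cg i : (i < n.+1)%N -> gamma`_i = P (n.+1 - i) * c (n.+1 - i).
  by move=> lt; rewrite coef_poly lt.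
have ca i : (i < n.+1)%N -> alpha`_i = P (n.+1 - i) * a (n.+1 - i).
  by move=> lt; rewrite coef_poly lt.
split.
- have := coefE n.+1 (ltnSn _).
  rewrite /chi coefB mulrBl coefB coefXM coefCM coefCM !coefB !coefXn /= eqxx.
  rewrite [n == n.+1]ltn_eqF // [gamma`_n.+1]nth_default ?size_poly //.
  rewrite [alpha`_n.+1]nth_default ?size_poly // cg // subSn // subnn /P big_geq //.
  move=> e; rewrite -[RHS]oppr0 -[in RHS]e mulr0n mulr1n; ring.
- move=> i /andP[i0 le]; have := coefE (n.+1 - i)%N.
  have -> : (n.+1 - i = (n - i).+1)%N by lia.
  rewrite /chi coefB mulrBl coefB coefXM coefCM coefCM !coefB !coefXn /=.
  rewrite !cg ?ca; [|lia|lia|lia].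
  have -> : (n - i == n.+1)%N = false by lia.
  have -> : ((n - i).+1 == n.+1)%N = false by lia.
  have -> : (n.+1 - (n - i).+1 = i)%N by lia.
  have -> : (n.+1 - (n - i) = i.+1)%N by lia.
  have -> : ((n - i).+1 < n.+2)%N by lia.
  move=> /(_ isT); rewrite !mulr0n => e; apply/eqP.
  rewrite -subr_eq0 -oppr_eq0 -[X in _ == X]e.
  apply/eqP; ring.
- have := coefE 0%N isT.
  rewrite /chi coefB mulrBl coefB coefXM coefCM coefCM !coefB !coefXn /= cg // ca //.
  rewrite subn0.
  by move=> e; rewrite -[RHS]e; ring.
Qed.

End NilpotentShape.

(** * Partial derivatives and substitution *)

Lemma mpoly_ring_ind (k : comNzRingType) n (P : {mpoly k[n]} -> Prop) :
    (forall c, P c%:MP) -> (forall i, P 'X_i) ->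
    (forall p q, P p -> P q -> P (p + q)) ->
    (forall p q, P p -> P q -> P (p * q)) ->
  forall p, P p.
Proof.
move=> PC PX PD PM; elim/mpolyind => [|c m p _ _ Pp]; first by rewrite -mpolyC0.
apply: PD => //; rewrite -mul_mpolyC; apply: (PM) => //.
rewrite mpolyXE_id; elim/big_ind: _ => // [|i _]; first by rewrite -mpolyC1.
elim: (m i) => [|j IH]; first by rewrite expr0 -mpolyC1.
by rewrite exprS; apply: PM.
Qed.

Lemma mderivU (k : nzRingType) n (i j : 'I_n) :
  'X_i^`M(j) = (i == j)%:R%:MP :> {mpoly k[n]}.
Proof.
rewrite mderivX mnm1E; case: eqP => [->|_]; last by rewrite scale0r mpolyC0.
by rewrite scale1r -[X in (X - _)%MM]add0m addmK mpolyX0 mpolyC1.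
Qed.

Lemma mpolyC_injective (k : nzRingType) n : injective (@mpolyC n k).
Proof. by move=> a b /mpolyP/(_ 0%MM); rewrite !mcoeffC eqxx !mulr1. Qed.

Lemma pchar_mpoly0 (k : idomainType) n :
  [pchar k] =i pred0 -> [pchar {mpoly k[n]}] =i pred0.
Proof. by apply: (@pchar0_inj _ _ (@mpolyC n k)); exact: mpolyC_injective. Qed.

Lemma mderiv_horner_var (k : comNzRingType) n (x j : 'I_n) (b : {poly k}) :
  ((map_poly (@mpolyC n k) b).['X_x])^`M(j) =
  (x == j)%:R * (map_poly (@mpolyC n k) b^`()).['X_x].
Proof.
elim/poly_ind: b => [|b c IH]; first by rewrite deriv0 !rmorph0 !horner0 mderivC mulr0.
rewrite derivMXaddC !rmorphD !rmorphM /= !map_polyX !map_polyC /= !hornerE.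
rewrite mderivD mderivM IH mderivU mderivC addr0.
case: (x == j); rewrite ?mulr1n ?mulr0n ?mpolyC1 ?mpolyC0; ring.
Qed.

Lemma comp_mpolyX_tnth (k : comNzRingType) n (N : polymap k n) i :
  'X_i \mPo N = tnth N i.
Proof. by rewrite comp_mpolyXU -tnth_nth. Qed.

Lemma mderiv_comp (k : comNzRingType) n (p : {mpoly k[n]})
    (N : n.-tuple {mpoly k[n]}) j :
  (p \mPo N)^`M(j) = \sum_l (p^`M(l) \mPo N) * (tnth N l)^`M(j).
Proof.
elim/mpoly_ring_ind: p => [c|i|p q IHp IHq|p q IHp IHq].
- rewrite comp_mpolyC mderivC big1 // => l _.
  by rewrite mderivC comp_mpoly0 mul0r.
- rewrite comp_mpolyXU -tnth_nth (bigD1 i) //= big1 => [|l li].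
    by rewrite mderivU eqxx mpolyC1 comp_mpoly1 mul1r addr0.
  by rewrite mderivU eq_sym (negPf li) mpolyC0 comp_mpoly0 mul0r.
- rewrite comp_mpolyD mderivD IHp IHq -big_split; apply: eq_bigr => l _.
  by rewrite mderivD comp_mpolyD mulrDl.
rewrite rmorphM /= mderivM IHp IHq mulr_suml mulr_sumr -big_split.
apply: eq_bigr => l _; rewrite mderivM comp_mpolyD !rmorphM /=; ring.
Qed.

(** In characteristic zero this lemma and the next one replace the variables of a
    polynomial by vanishing partial derivatives, which behave well under
    substitution. *)
Lemma mderiv_notin_mvars (k : nzRingType) n (p : {mpoly k[n]}) j :
  j \notin mvars p -> p^`M(j) = 0.
Proof.
rewrite inE => /hasPn pj; apply/mpolyP => m; rewrite mcoeff_mderiv mcoeff0.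
have [|/memN_msupp_eq0 ->] := boolP ((m + U_(j))%MM \in msupp p);
  last by rewrite mul0rn.
by move/pj; rewrite negbK mnmDE mnm1E eqxx addn1.
Qed.

Lemma mderiv_eq0_notin_mvars (k : idomainType) n (p : {mpoly k[n]}) j :
  [pchar k] =i pred0 -> p^`M(j) = 0 -> j \notin mvars p.
Proof.
move=> char0 dp; rewrite inE; apply/hasPn => m; rewrite mcoeff_msupp negbK.
apply: contraNT => mj; apply/eqP.
have/mpolyP/(_ (m - U_(j))%MM) := dp; rewrite mcoeff_mderiv mcoeff0.
rewrite submK; first exact: mulrnS_eq0.
by apply/mnm_lepP => i; rewrite mnm1E; case: eqP => // <-; rewrite lt0n.
Qed.

Lemma comp_mpoly_eq_mvars (k : comNzRingType) n (p : {mpoly k[n]})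
    (N N' : n.-tuple {mpoly k[n]}) :
  (forall l, l \in mvars p -> tnth N l = tnth N' l) -> p \mPo N = p \mPo N'.
Proof.
move=> NN'; rewrite !comp_mpolyE; apply: eq_big_seq => m mp; congr (_ *: _).
apply: eq_bigr => l _; have [-> //|ml] := eqVneq (m l) 0%N.
by rewrite NN' // inE; apply/hasP; exists m.
Qed.

Lemma comp_mpoly_eq (k : idomainType) n (p : {mpoly k[n]})
    (N N' : n.-tuple {mpoly k[n]}) : [pchar k] =i pred0 ->
  (forall l, p^`M(l) != 0 -> tnth N l = tnth N' l) -> p \mPo N = p \mPo N'.
Proof.
move=> char0 NN'; apply: comp_mpoly_eq_mvars => l lp; apply: NN'.
by apply: contraL lp => /eqP; apply: mderiv_eq0_notin_mvars.
Qed.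

Lemma comp_mpoly_fix (k : idomainType) n (p : {mpoly k[n]}) (N : polymap k n) :
    [pchar k] =i pred0 -> (forall l, p^`M(l) != 0 -> tnth N l = 'X_l) ->
  p \mPo N = p.
Proof.
move=> char0 pN; rewrite -[RHS]comp_mpoly_id; apply: comp_mpoly_eq => // l pl.
by rewrite pN // tnth_mktuple.
Qed.

Lemma mpoly_antiderivative (k : fieldType) n (p : {mpoly k[n]}) (j : 'I_n) :
    [pchar k] =i pred0 ->
  exists q, q^`M(j) = p /\ forall l, l != j -> p^`M(l) = 0 -> q^`M(l) = 0.
Proof.
move=> char0.
pose q := \sum_(m <- msupp p) (p@_m / (m j).+1%:R) *: 'X_[m + U_(j)].
exists q; split=> [|l lj pl].
  rewrite [RHS]mpolyE /q raddf_sum; apply: eq_bigr => m _ /=.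
  rewrite mderivZ mderivX addmK scalerA mnmDE mnm1E eqxx addn1 divfK //.
  exact: natrS_neq0.
rewrite /q raddf_sum big1_seq // => m /= mp.
have := mderiv_eq0_notin_mvars char0 pl; rewrite inE => /hasPn/(_ m mp).
rewrite negbK => /eqP ml; rewrite mderivZ mderivX mnmDE mnm1E ml eq_sym (negPf lj).
by rewrite scale0r scaler0.
Qed.

(** * Triangular maps are elementary *)

Lemma elementary_mapP (k : comNzRingType) n (i : 'I_n) (a : {mpoly k[n]}) :
  i \notin mvars a -> exists E : polymap k n,
  [/\ elementary_group E, tnth E i = 'X_i + a
    & forall j, j != i -> tnth E j = 'X_j].
Proof.
move=> ia; exists (elementary_map i a); split.
- by apply: EG_elementary; exists i, a.
- by rewrite tnth_mktuple eqxx.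
by move=> j /negPf ji; rewrite tnth_mktuple ji.
Qed.

Lemma elementary_group_factor (k : comNzRingType) n (F N : polymap k n) :
  elementary_group N -> elementary_group (polymap_comp F N) -> elementary_group F.
Proof.
move=> EN EFN; have [N' [NN' N'N]] := elementary_group_invertible EN.
have -> : F = polymap_comp (polymap_comp F N) N'.
  by rewrite -polymap_compA NN' polymap_compm1.
by apply: EG_comp => //; apply: EG_inv EN _.
Qed.

(** A variable i of least rank among those with a i != 0 occurs in none of the
    a j, so the elementary map at i can be split off on the right. *)
Lemma elementary_group_triangular (k : fieldType) n (a : 'I_n -> {mpoly k[n]})
    (rk : 'I_n -> nat) :
    (forall i j, j \in mvars (a i) -> (rk i < rk j)%N) ->
  elementary_group [tuple 'X_i + a i | i < n].
Proof.
move: {2}_.+1 (ltnSn #|[set i | a i != 0]|) => s.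
elim: s a => // s IH a; rewrite ltnS => le_s lt_rk.
have [a0|/set0Pn[i0 ai0]] := eqVneq [set i | a i != 0] set0.
  suff -> : [tuple 'X_i + a i | i < n] = polymap_id k n by apply: EG_id.
  apply: eq_from_tnth => i; rewrite !tnth_mktuple.
  by have/setP/(_ i) := a0; rewrite !inE => /negbFE/eqP ->; rewrite addr0.
rewrite inE in ai0.
have [i ai min_i] := @arg_minnP _ i0 (fun i => a i != 0) rk ai0.
have nai j : i \notin mvars (a j).
  have [aj|aj] := eqVneq (a j) 0; first by rewrite aj inE msupp0.
  apply/negP => /lt_rk; by rewrite ltnNge min_i.
pose a' j := if j == i then 0 else a j.
have -> : [tuple 'X_j + a j | j < n] =
    polymap_comp [tuple 'X_j + a' j | j < n] (elementary_map i (a i)).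
  apply: eq_from_tnth => j; rewrite !tnth_mktuple comp_mpolyD comp_mpolyXU.
  rewrite -tnth_nth tnth_mktuple /a'; case: eqP => [->|_].
    by rewrite comp_mpoly0 addr0.
  by rewrite comp_mpoly_elementary.
apply: EG_comp; last by apply: EG_elementary; exists i, (a i).
apply: IH => [|j l]; last first.
  by rewrite /a'; case: eqP => [_|_ /lt_rk//]; rewrite inE msupp0.
apply: leq_trans le_s; apply: proper_card; apply/properP; split.
  by apply/subsetP => j; rewrite !inE /a'; case: ifP => //; rewrite eqxx.
by exists i; rewrite inE // /a' !eqxx.
Qed.

(** * Separating two of the variables *)

Section PlanarEvaluation.
Variables (k R : comNzRingType) (n : nat) (f : {rmorphism k -> R}).
Variables (x y : 'I_n) (h : 'I_n -> R).

(** Reads a polynomial in n variables as one in y over polynomials in x.  With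
    R := {mpoly k[n]} and h := 'X_i this is injective; with R := k and h := 0 it
    sets the other variables to 0 and makes the constants invertible. *)
Definition planar_eval : {mpoly k[n]} -> {poly {poly R}} :=
  mmap (polyC \o (polyC \o f))
    (fun i => if i == x then 'X%:P else if i == y then 'X else (h i)%:P%:P).

HB.instance Definition _ := GRing.RMorphism.on planar_eval.

Lemma planar_evalC c : planar_eval c%:MP = (f c)%:P%:P.
Proof. by rewrite /planar_eval mmapC. Qed.

Lemma planar_evalX i : planar_eval 'X_i =
  if i == x then 'X%:P else if i == y then 'X else (h i)%:P%:P.
Proof. by rewrite /planar_eval mmapX mmap1U. Qed.

Lemma planar_eval_horner (a b : R) p : (planar_eval p).[a%:P].[b] =
  mmap f (fun i => if i == x then b else if i == y then a else h i) p.
Proof.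
elim/mpoly_ring_ind: p => [c|i|p q IHp IHq|p q IHp IHq].
- by rewrite planar_evalC !hornerC mmapC.
- rewrite planar_evalX mmapX mmap1U; case: eqP => _; first by rewrite hornerC hornerX.
  by case: eqP => _; rewrite ?hornerX ?hornerC // hornerC.
- by rewrite !rmorphD /= !hornerD IHp IHq.
by rewrite !rmorphM /= !hornerM IHp IHq.
Qed.

Lemma planar_eval_horner_var (b : {poly k}) :
  planar_eval (map_poly (@mpolyC n k) b).['X_x] = (map_poly f b)%:P.
Proof.
elim/poly_ind: b => [|b c IH]; first by rewrite !rmorph0 horner0 rmorph0.
rewrite 2!rmorphD 2!rmorphM /= !map_polyX !map_polyC /= !hornerE.
by rewrite rmorphD rmorphM /= IH planar_evalX eqxx planar_evalC -polyCM -polyCD.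
Qed.

Hypothesis xy : x != y.

Lemma planar_eval_mderiv_y p : planar_eval p^`M(y) = (planar_eval p)^`().
Proof.
elim/mpoly_ring_ind: p => [c|i|p q IHp IHq|p q IHp IHq].
- by rewrite mderivC planar_evalC derivC rmorph0.
- rewrite mderivU planar_evalC planar_evalX; have [->|ix] := eqVneq i x.
    by rewrite (negPf xy) derivC rmorph0.
  by case: eqP => _; rewrite ?derivX ?derivC rmorph_nat.
- by rewrite mderivD !rmorphD /= derivD IHp IHq.
by rewrite mderivM !(rmorphD, rmorphM) /= derivM IHp IHq.
Qed.

End PlanarEvaluation.

Section PlanarEvaluationDomain.
Variables (k : comNzRingType) (R : idomainType) (n : nat) (f : {rmorphism k -> R}).
Variables (x y : 'I_n) (h : 'I_n -> R).

Lemma planar_eval_mderiv_x p :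
  planar_eval f x y h p^`M(x) = xderiv (planar_eval f x y h p).
Proof.
elim/mpoly_ring_ind: p => [c|i|p q IHp IHq|p q IHp IHq].
- by rewrite mderivC planar_evalC xderivC derivC rmorph0 polyC0.
- rewrite mderivU planar_evalC planar_evalX; have [_|ix] := eqVneq i x.
    by rewrite xderivC derivX rmorph1.
  have [_|iy] := eqVneq i y; last by rewrite xderivC derivC rmorph0 polyC0.
  rewrite rmorph0 polyC0; apply/polyP => j.
  rewrite coef_map coefX coef0 /=; case: (_ == _); rewrite /= ?deriv0 //.
  by rewrite -[1]/(1%:P) derivC.
- by rewrite mderivD !rmorphD /= xderivD IHp IHq.
by rewrite mderivM !(rmorphD, rmorphM) /= xderivM IHp IHq.
Qed.

End PlanarEvaluationDomain.

Lemma planar_eval_generic_inj (k : comNzRingType) n (x y : 'I_n) :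
  injective (planar_eval (@mpolyC n k) x y (fun i => 'X_i)).
Proof.
apply: (can_inj (g := fun q => q.[('X_y)%:P].['X_x])) => p.
rewrite planar_eval_horner -[RHS]comp_mpoly_id /comp_mpoly.
rewrite /mmap; apply: eq_bigr => m _; congr (_ * _); apply: mmap1_eq => i.
by rewrite tnth_mktuple; case: eqP => [->//|_]; case: eqP => [->|].
Qed.

Lemma planar_eval_generic (k : idomainType) n (x y : 'I_n) (p : {mpoly k[n]}) :
    [pchar k] =i pred0 -> (forall j, j != x -> j != y -> p^`M(j) = 0) ->
  planar_eval (@mpolyC n k) x y (fun i => 'X_i) p =
  map_poly (map_poly (@mpolyC n k)) (planar_eval idfun x y (fun=> 0) p).
Proof.
move=> char0 pxy; rewrite /planar_eval /mmap rmorph_sum.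
apply: eq_big_seq => m mp /=; rewrite rmorphM /= !map_polyC /= map_polyC; congr (_ * _).
rewrite /mmap1 rmorph_prod; apply: eq_bigr => i _ /=; rewrite rmorphXn /=.
have [->|ix] := eqVneq i x; first by rewrite map_polyC /= map_polyX.
have [->|iy] := eqVneq i y; first by rewrite map_polyX.
have /mderiv_eq0_notin_mvars := pxy i ix iy.
rewrite inE => /(_ char0)/hasPn/(_ m mp); rewrite negbK => /eqP ->.
by rewrite !expr0.
Qed.

(** The planar ring morphisms and partial derivatives are abstract here.  Degrees
    are counted in E, with coefficients in the other variables, as the d i may
    involve these; u itself has coefficients in the field K, over which E0 lives. *)
Section PlanarShift.
Variables (A : comNzRingType) (Dx Dy : {additive A -> A}).
Variables (K : fieldType) (R : idomainType).
Variables (f : {rmorphism K -> R}) (E : {rmorphism A -> {poly {poly R}}}).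
Variable E0 : {rmorphism A -> {poly {poly K}}}.
Hypotheses (char0K : [pchar K] =i pred0) (char0R : [pchar R] =i pred0).
Hypothesis E_inj : injective E.
Hypothesis E_Dx : forall p, E (Dx p) = xderiv (E p).
Hypothesis E_Dy : forall p, E (Dy p) = (E p)^`().
Hypothesis E0_Dx : forall p, E0 (Dx p) = xderiv (E0 p).
Hypothesis E0_Dy : forall p, E0 (Dy p) = (E0 p)^`().
Variables (u : A) (v d : nat -> A) (M : nat).
Hypothesis u_plane : E u = map_poly (map_poly f) (E0 u).
Hypothesis Dxu_plane : E (Dx u) = map_poly (map_poly f) (E0 (Dx u)).
Hypothesis Dyu_plane : E (Dy u) = map_poly (map_poly f) (E0 (Dy u)).
Hypothesis Dyu_neq0 : Dy u != 0.
Hypothesis M_gt0 : (0 < M)%N.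
Hypothesis v1 : Dy (v 1) = - Dx u.
Hypothesis vS : forall i, (0 < i < M)%N -> [/\ d i != 0, Dy (d i) = 0 &
  d i * Dy (v i.+1) = Dx u * Dy (v i) - Dy u * Dx (v i)].
Hypothesis vM : Dx u * Dy (v M) - Dy u * Dx (v M) = 0.

Lemma planar_lead_coef_const : (lead_coef (E u))^`() = 0.
Proof.
have Ed i : (0 < i < M)%N -> E (d i) = ((E (d i))`_0)%:P.
  move=> /vS[_ dy _]; apply: size1_polyC.
  have := size_deriv_char0 (E (d i)) (char0_poly char0R).
  by rewrite -E_Dy dy rmorph0 size_poly0; case: (size _) => [|[]].
pose D i := (E (d i))`_0.
apply: (@chain_lead_coef_const _ char0R (E u) (E \o v) D M) => //=.
- rewrite ltnNge; apply: contra Dyu_neq0 => /size1_polyC Eu.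
  by apply/eqP/E_inj; rewrite E_Dy Eu derivC rmorph0.
- by rewrite -E_Dy v1 -E_Dx rmorphN.
- move=> i iM; have [di _ e] := vS iM; split.
    rewrite -polyC_eq0 /D -Ed //; apply: contraNneq di => di0.
    by apply/eqP/E_inj; rewrite di0 rmorph0.
  by rewrite /D -Ed // -!E_Dy -!E_Dx -!rmorphM -rmorphB /= e.
- by rewrite -!E_Dy -!E_Dx -!rmorphM -rmorphB /= vM rmorph0.
Qed.

Lemma planar_shift_poly m Q : Dx u ^+ m = Dy u * Q ->
  exists b : {poly K}, E (Dx u) = (map_poly f b^`())%:P * E (Dy u).
Proof.
move=> uQ.
have [b bE] : exists b, xderiv (E0 u) = b^`()%:P * (E0 u)^`().
  apply: (@xderiv_eq_shift _ char0K _ m).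
    apply: (map_poly_inj f); rewrite rmorph0 -deriv_map -planar_lead_coef_const.
    rewrite u_plane lead_coef_map_inj ?rmorph0 //; exact: map_poly_inj.
  by rewrite -E0_Dy -E0_Dx -rmorphXn uQ rmorphM dvdp_mulr.
exists b; rewrite Dxu_plane Dyu_plane E0_Dx E0_Dy bE rmorphM /=.
by rewrite map_polyC.
Qed.

End PlanarShift.

(** If u_y = 0 then u_x is nilpotent, hence 0, and b = 0 will do. *)
Lemma planar_shift (k : fieldType) (char0 : [pchar k] =i pred0) n (x y : 'I_n)
    (xy : x != y) (u : {mpoly k[n]}) (v d : nat -> {mpoly k[n]}) M m Q :
    (forall j, j != x -> j != y -> u^`M(j) = 0) -> (0 < M)%N ->
    (v 1)^`M(y) = - u^`M(x) ->
    (forall i, (0 < i < M)%N -> [/\ d i != 0, (d i)^`M(y) = 0 &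
      d i * (v i.+1)^`M(y) = u^`M(x) * (v i)^`M(y) - u^`M(y) * (v i)^`M(x)]) ->
    u^`M(x) * (v M)^`M(y) - u^`M(y) * (v M)^`M(x) = 0 ->
    u^`M(x) ^+ m = u^`M(y) * Q ->
  exists b : {mpoly k[n]}, (forall j, j != x -> b^`M(j) = 0) /\
    u^`M(x) = b^`M(x) * u^`M(y).
Proof.
move=> u_xy M0 v1 vS vM uQ.
have [uy0|uy0] := eqVneq u^`M(y) 0.
  exists 0; split=> [j _|]; rewrite mderiv0 ?mul0r //.
  by move/eqP: uQ; rewrite uy0 mul0r expf_eq0 => /andP[_ /eqP].
have char0A := pchar_mpoly0 n char0.
have xu_xy j : j != x -> j != y -> u^`M(x)^`M(j) = 0.
  by move=> jx jy; rewrite mderiv_comm u_xy ?mderiv0.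
have yu_xy j : j != x -> j != y -> u^`M(y)^`M(j) = 0.
  by move=> jx jy; rewrite mderiv_comm u_xy ?mderiv0.
have EL := fun p => @planar_eval_generic k n x y p char0.
have Einj := @planar_eval_generic_inj k n x y.
have [b bE] := @planar_shift_poly _ (mderiv x) (mderiv y) _ _ (@mpolyC n k)
  (planar_eval (@mpolyC n k) x y (fun i => 'X_i))
  (planar_eval (@idfun k) x y (fun=> 0)) char0 char0A Einj
  (planar_eval_mderiv_x _ _ _ _) (planar_eval_mderiv_y _ _ xy)
  (planar_eval_mderiv_x _ _ _ _) (planar_eval_mderiv_y _ _ xy)
  _ _ _ _ (EL _ u_xy) (EL _ xu_xy) (EL _ yu_xy) uy0 M0 v1 vS vM _ _ uQ.
exists (map_poly (@mpolyC n k) b).['X_x]; split=> [j jx|].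
  by rewrite mderiv_horner_var eq_sym (negPf jx) mul0r.
rewrite mderiv_horner_var eqxx mul1r; apply: Einj.
by rewrite rmorphM /= planar_eval_horner_var.
Qed.

(** * Chain maps with nilpotent Jacobian matrix *)

Section ChainMaps.
Variables (k : fieldType) (n : nat) (H : polymap k n.+2).
Hypothesis char0 : [pchar k] =i pred0.
Hypothesis H_shape : forall i j : 'I_n.+2,
  (1 < j)%N -> i.+1 != j -> (tnth H i)^`M(j) = 0.
Hypothesis JH_nilpotent : nilpotent_mx (jacobian H).

Let x : 'I_n.+2 := ord0.
Let y : 'I_n.+2 := inord 1.
Let v i := tnth H (inord i).
Let d i := (v i)^`M(inord i.+1).
Let u := v 0.

Lemma val_y : y = 1%N :> nat. Proof. by rewrite /y inordK. Qed.

Lemma x_neq_y : x != y. Proof. by rewrite -val_eqE /= val_y. Qed.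

Lemma gt1_ord (j : 'I_n.+2) : (1 < j)%N = (j != x) && (j != y).
Proof. by rewrite -!val_eqE /= val_y; case: j => [[|[|j]] lj]. Qed.

Lemma mderiv_v i (j : 'I_n.+2) : (i < n.+2)%N -> (1 < j)%N -> i.+1 != j ->
  (v i)^`M(j) = 0.
Proof. by move=> lt_i j1 ij; apply: H_shape; rewrite ?inordK. Qed.

Lemma mderiv_u (j : 'I_n.+2) : j != x -> j != y -> u^`M(j) = 0.
Proof.
move=> jx jy; have j1 : (1 < j)%N by rewrite gt1_ord jx.
by apply: mderiv_v; rewrite // neq_ltn j1.
Qed.

Let chain_end i := (0 < i)%N && ((i == n.+1) || (d i == 0)).

Lemma chain_end_exists : exists i, chain_end i.
Proof. by exists n.+1; rewrite /chain_end eqxx. Qed.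

Let M := ex_minn chain_end_exists.

Lemma M_bounds : (0 < M <= n.+1)%N.
Proof.
rewrite /M; case: ex_minnP => M' /andP[-> _] minM' /=.
by apply: minM'; rewrite /chain_end eqxx.
Qed.

Lemma d_neq0 i : (0 < i < M)%N -> d i != 0.
Proof.
case/andP=> i0; rewrite /M; case: ex_minnP => M' _ minM' iM.
apply/negP => di; move: (minM' i); rewrite /chain_end i0 di orbT => /(_ isT).
by rewrite leqNgt iM.
Qed.

Lemma d_end : (M < n.+1)%N -> d M = 0.
Proof.
rewrite /M; case: ex_minnP => M' /andP[_ /orP[/eqP->|/eqP//]].
by rewrite ltnn.
Qed.

Lemma jacobian_shape (i j : 'I_n.+2) :
  (1 < j)%N -> i.+1 != j -> jacobian H i j = 0.
Proof. by move=> j1 ij; rewrite mxE H_shape. Qed.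

Lemma chain_relations :
  [/\ (v 1)^`M(y) = - u^`M(x),
      forall i, (0 < i < M)%N -> d i * (v i.+1)^`M(y) =
        u^`M(x) * (v i)^`M(y) - u^`M(y) * (v i)^`M(x)
    & u^`M(x) * (v M)^`M(y) - u^`M(y) * (v M)^`M(x) = 0].
Proof.
have [m Jm] := JH_nilpotent.
have [e1 eS eE] := nilpotent_chain jacobian_shape Jm.
have {}e1 : u^`M(x) + (v 1)^`M(y) = 0 by move: e1; rewrite !mxE.
pose P i := \prod_(1 <= j < i) d j.
have PE i : \prod_(1 <= j < i) jacobian H (inord j) (inord j.+1) = P i.
  by apply: eq_bigr => j _; rewrite mxE.
have P0 i : (i <= M)%N -> P i != 0.
  move=> iM; rewrite prodf_seq_neq0; apply/allP => j.
  rewrite mem_index_iota => /andP[j0 ji] /=.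
  by apply: d_neq0; rewrite j0 (leq_trans ji).
have {}eS i : (0 < i <= n)%N -> P i.+1 * (v i.+1)^`M(y) =
    P i * (u^`M(x) * (v i)^`M(y) - u^`M(y) * (v i)^`M(x)).
  by move/eS; rewrite !PE !mxE.
have /andP[M0 Mn] := M_bounds.
have PS i : (0 < i)%N -> P i.+1 = P i * d i by move=> i0; rewrite /P big_nat_recr.
split.
- by apply/eqP; rewrite -addr_eq0 addrC e1.
- move=> i /andP[i0 iM]; apply: (mulfI (P0 i (ltnW iM))).
  by rewrite mulrA -PS // eS // i0 -ltnS (leq_trans iM).
apply: (mulfI (P0 M (leqnn M))); rewrite mulr0.
have [Mlt|Mge] := ltnP M n.+1.
  by rewrite -eS ?M0 // PS // d_end // mulr0 mul0r.
have ME : M = n.+1 by apply/eqP; rewrite eqn_leq Mn.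
by rewrite ME; move: eE; rewrite !PE !mxE.
Qed.

(** By induction along the chain: the variable x_(i+2) occurs neither in d_i nor in
    D v_i, and d_i is nonzero, so it does not occur in (v_(i+1))_y. *)
Lemma mderiv_y_v i (j : 'I_n.+2) : (0 < i <= M)%N -> j != x -> j != y ->
  (v i)^`M(y)^`M(j) = 0.
Proof.
have [e1 eS _] := chain_relations; have /andP[_ Mn] := M_bounds.
elim: i j => // i IH j; rewrite /= => iM jx jy.
have j1 : (1 < j)%N by rewrite gt1_ord jx.
have uj := mderiv_u jx jy.
have [i0|i0] := posnP i.
  by rewrite i0 e1 mderivN mderiv_comm uj mderiv0 oppr0.
have [ij|ij] := eqVneq i.+2 j; last first.
  by rewrite mderiv_comm mderiv_v ?mderiv0 //; apply: leq_ltn_trans iM _.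
have iM' : (0 < i < M)%N by rewrite i0.
have lt_i : (i < n.+2)%N by rewrite ltnW // ltnS (leq_trans iM).
have vij : (v i)^`M(j) = 0 by apply: mderiv_v; rewrite // -ij neq_ltn leqnn.
have := congr1 (mderiv j) (eS i iM').
rewrite mderivB !mderivM.
have -> : (d i)^`M(j) = 0 by rewrite mderiv_comm vij mderiv0.
rewrite [u^`M(x)^`M(j)]mderiv_comm [u^`M(y)^`M(j)]mderiv_comm.
rewrite [(v i)^`M(x)^`M(j)]mderiv_comm uj vij !mderiv0.
rewrite IH ?i0 ?(ltnW iM) // !(mul0r, mulr0, add0r, addr0, oppr0) => /eqP.
by rewrite mulf_eq0 (negPf (d_neq0 iM')) => /eqP.
Qed.

Lemma straightening : exists b : {mpoly k[n.+2]},
  (forall j, j != x -> b^`M(j) = 0) /\ u^`M(x) = b^`M(x) * u^`M(y).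
Proof.
have [e1 eS eE] := chain_relations; have /andP[M0 Mn] := M_bounds.
have [m Jm] := JH_nilpotent.
have [Q] := dvd_diag_exp jacobian_shape Jm; rewrite !mxE => uQ.
apply: (planar_shift (v := v) (d := d) char0 x_neq_y mderiv_u M0 e1 _ eE uQ) => i iM.
split; [exact: d_neq0| |exact: eS].
have /andP[i0 iM'] := iM.
have i2 : (i.+1 < n.+2)%N by rewrite ltnS (leq_trans iM').
have : (1 < (inord i.+1 : 'I_n.+2))%N by rewrite inordK.
rewrite gt1_ord => /andP[jx jy].
by rewrite /d mderiv_comm; apply: mderiv_y_v; rewrite // i0 ltnW.
Qed.

Lemma mderiv_comp_plane (p : {mpoly k[n.+2]}) (N : polymap k n.+2) l :
    (forall j, j != x -> j != y -> p^`M(j) = 0) ->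
  (p \mPo N)^`M(l) = (p^`M(x) \mPo N) * (tnth N x)^`M(l)
    + (p^`M(y) \mPo N) * (tnth N y)^`M(l).
Proof.
move=> pxy; rewrite mderiv_comp (bigD1 x) // (bigD1 y) 1?eq_sym ?x_neq_y //=.
rewrite big1 ?addr0 // => j /andP[jx jy].
by rewrite pxy // comp_mpoly0 mul0r.
Qed.

Lemma comp_plane (p : {mpoly k[n.+2]}) (N N' : polymap k n.+2) :
    (forall j, j != x -> j != y -> p^`M(j) = 0) ->
  tnth N x = tnth N' x -> tnth N y = tnth N' y -> p \mPo N = p \mPo N'.
Proof.
move=> pxy ex ey; apply: comp_mpoly_eq => // l.
by have [->//|lx] := eqVneq l x; have [->//|ly] := eqVneq l y; rewrite pxy ?eqxx.
Qed.

(** As u = g(y + b(x)), the map (x, y) -> (x + u, y + b(x)) is inverted by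
    N = (x - g(y), y - b(x - g(y)), x_2, ...).  Since u o N = g, its derivative
    with respect to y is (-u_y, 1 + u_x) o N on the first two components. *)
Lemma straightening_plane : exists N : polymap k n.+2,
  [/\ elementary_group N, u \mPo N = 'X_x - tnth N x,
      forall l, l != x -> l != y -> (tnth N x)^`M(l) = 0 /\ (tnth N y)^`M(l) = 0,
      forall i : 'I_n.+2, (1 < i)%N -> tnth N i = 'X_i
    & (tnth N x)^`M(y) = - (u^`M(y) \mPo N) /\
      (tnth N y)^`M(y) = 1 + (u^`M(x) \mPo N)].
Proof.
have [b [b_x ub]] := straightening.
have xy := x_neq_y; have yx : y != x by rewrite eq_sym.
have b_y : y \notin mvars (- b).
  by rewrite mvarsN; apply: mderiv_eq0_notin_mvars => //; apply: b_x.
have [T [ET Ty Tj]] := elementary_mapP b_y.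
have Tx := Tj x xy.
have [g gE] : exists g, g = u \mPo T by exists (u \mPo T).
have g_y l : l != y -> g^`M(l) = 0.
  move=> ly; rewrite gE mderiv_comp_plane; last exact: mderiv_u.
  rewrite Tx Ty mderivD mderivN !mderivU [y == l]eq_sym (negPf ly) mpolyC0 add0r.
  have [<-|xl] := eqVneq x l; last first.
    by rewrite b_x 1?eq_sym // mpolyC0 oppr0 !mulr0 addr0.
  have -> : u^`M(x) \mPo T = b^`M(x) * (u^`M(y) \mPo T).
    rewrite ub rmorphM /= [b^`M(x) \mPo T]comp_mpoly_fix // => l' bl'.
    apply: Tj; apply: contraNneq bl' => ->.
    by rewrite mderiv_comm b_x ?mderiv0.
  rewrite mpolyC1; ring.
have g_mvars : x \notin mvars (- g).
  by rewrite mvarsN; apply: mderiv_eq0_notin_mvars => //; apply: g_y.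
have [E [EE Ex Ej]] := elementary_mapP g_mvars.
have Ey := Ej y yx.
have [beta bE] : exists beta, beta = b \mPo E by exists (b \mPo E).
have [N NE] : exists N, N = polymap_comp T E by exists (polymap_comp T E).
have Nx : tnth N x = 'X_x - g by rewrite NE tnth_mktuple Tx comp_mpolyX_tnth.
have Ny : tnth N y = 'X_y - beta.
  by rewrite NE tnth_mktuple Ty comp_mpolyD comp_mpolyN (comp_mpolyX_tnth E y) Ey bE.
have bxE : b^`M(x) \mPo E = b^`M(x) \mPo N.
  apply: comp_mpoly_eq => // l bl; have -> : l = x; last by rewrite Nx Ex.
  by apply: contraNeq bl => lx; rewrite mderiv_comm b_x ?mderiv0.
have beta_l l : beta^`M(l) = (b^`M(x) \mPo N) * ((x == l)%:R%:MP - g^`M(l)).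
  rewrite bE mderiv_comp_plane; last by move=> j jx _; apply: b_x.
  by rewrite Ex bxE (b_x y yx) comp_mpoly0 mul0r addr0 mderivB mderivU.
have uN : u \mPo N = g.
  rewrite NE -comp_mpolyA -gE; apply: comp_mpoly_fix => // l gl.
  by have -> : l = y by apply: contraNeq gl => /g_y ->.
have Nx_y : (tnth N x)^`M(y) = - g^`M(y).
  by rewrite Nx mderivB mderivU (negPf xy) mpolyC0 sub0r.
have Ny_y : (tnth N y)^`M(y) = 1 + (b^`M(x) \mPo N) * g^`M(y).
  rewrite Ny mderivB mderivU eqxx mpolyC1 beta_l (negPf xy) mpolyC0 sub0r.
  by rewrite mulrN opprK.
(* Differentiating u o N = g determines g_y, because u_x = b_x u_y. *)
have gy : g^`M(y) = u^`M(y) \mPo N.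
  rewrite -[in LHS]uN mderiv_comp_plane; last exact: mderiv_u.
  rewrite Nx_y Ny_y ub rmorphM /=; ring.
exists N; split.
- by rewrite NE; apply: EG_comp.
- rewrite uN Nx; ring.
- move=> l lx ly; have xl : (x == l) = false by rewrite eq_sym (negPf lx).
  have yl : (y == l) = false by rewrite eq_sym (negPf ly).
  rewrite Nx Ny; split; rewrite mderivB mderivU.
    by rewrite xl mpolyC0 g_y // subr0.
  by rewrite yl beta_l xl mpolyC0 g_y // subr0 mulr0 subr0.
- move=> i; rewrite gt1_ord => /andP[ix iy].
  by rewrite NE tnth_mktuple (Tj i iy) comp_mpolyX_tnth (Ej i ix).
by rewrite Nx_y Ny_y gy ub rmorphM.
Qed.

(** Correct each x_i with 1 < i <= M by an antiderivative with respect to y of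
    - (v_i)_y o N.  That polynomial involves only x and y, and N agrees on these
    with the map of the previous lemma, so the condition is not circular. *)
Lemma straightening_map : exists N : polymap k n.+2,
  [/\ elementary_group N, u \mPo N = 'X_x - tnth N x,
      forall i l, l != x -> l != y -> (tnth N i - 'X_i)^`M(l) = 0,
      forall i : 'I_n.+2, (M < i)%N -> tnth N i = 'X_i
    & forall i : 'I_n.+2, (i <= M)%N ->
      (tnth N i)^`M(y) = (i == y)%:R%:MP - ((tnth H i)^`M(y) \mPo N)].
Proof.
have [e1 _ _] := chain_relations; have /andP[M0 _] := M_bounds.
have [N0 [EN0 uN0 N0_xy N0i [N0x_y N0y_y]]] := straightening_plane.
have xy := x_neq_y.
have vE (i : 'I_n.+2) : v i = tnth H i by rewrite /v inord_val.
have Hy_xy (i j : 'I_n.+2) : (1 < i <= M)%N -> j != x -> j != y ->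
    (tnth H i)^`M(y)^`M(j) = 0.
  by move=> /andP[i1 iM]; rewrite -vE; apply: mderiv_y_v; rewrite ltnW.
have exists_a (i : 'I_n.+2) : exists q : {mpoly k[n.+2]},
    (~~ (1 < i <= M)%N -> q = 0) /\ ((1 < i <= M)%N ->
    q^`M(y) = - ((tnth H i)^`M(y) \mPo N0) /\
    forall l, l != x -> l != y -> q^`M(l) = 0).
  have [iM|_] := boolP (1 < i <= M)%N; last by exists 0.
  have [q [qy ql]] := mpoly_antiderivative ((tnth H i)^`M(y) \mPo N0) y char0.
  exists (- q); split=> // _; rewrite mderivN qy; split=> // l lx ly.
  rewrite mderivN ql ?oppr0 // mderiv_comp_plane; last by move=> j; apply: Hy_xy.
  by have [-> ->] := N0_xy l lx ly; rewrite !mulr0 addr0.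
have [a aP] := fin_all_exists exists_a.
have a_xy i l : l != x -> l != y -> (a i)^`M(l) = 0.
  have [a0 a1] := aP i; move=> lx ly; have [iM|iM] := boolP (1 < i <= M)%N.
    by have [_] := a1 iM; apply.
  by rewrite (a0 iM) mderiv0.
have [S SE] : exists S : polymap k n.+2, S = [tuple 'X_i + a i | i < n.+2].
  by exists [tuple 'X_i + a i | i < n.+2].
have Si i : tnth S i = 'X_i + a i by rewrite SE tnth_mktuple.
have S_le1 (i : 'I_n.+2) : (i <= 1)%N -> tnth S i = 'X_i.
  by move=> i1; rewrite Si (aP i).1 ?addr0 // ltnNge i1.
have ES : elementary_group S.
  rewrite SE.
  apply: (elementary_group_triangular (rk := fun i : 'I_n.+2 => (i <= 1)%N)) => i j.
  have [i1|i1] := leqP i 1; first by rewrite (aP i).1 ?inE ?msupp0 // ltnNge i1.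
  apply: contraLR; rewrite lt0b -ltnNge gt1_ord => /andP[jx jy].
  by apply: mderiv_eq0_notin_mvars => //; apply: a_xy.
have [N NE] : exists N, N = polymap_comp N0 S by exists (polymap_comp N0 S).
have comp_S p : (forall j, j != x -> j != y -> p^`M(j) = 0) -> p \mPo S = p.
  move=> pxy; apply: comp_mpoly_fix => // l pl; apply: S_le1; rewrite leqNgt gt1_ord.
  by apply: contra pl => /andP[lx ly]; rewrite pxy.
have Nx : tnth N x = tnth N0 x.
  by rewrite NE tnth_mktuple comp_S // => j jx jy; have [] := N0_xy j jx jy.
have Ny : tnth N y = tnth N0 y.
  by rewrite NE tnth_mktuple comp_S // => j jx jy; have [] := N0_xy j jx jy.
have Ni (i : 'I_n.+2) : (1 < i)%N -> tnth N i = 'X_i + a i.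
  by move=> i1; rewrite NE tnth_mktuple N0i // comp_mpolyX_tnth.
have comp_N p : (forall j, j != x -> j != y -> p^`M(j) = 0) -> p \mPo N = p \mPo N0.
  by move=> pxy; apply: comp_plane.
have ux_xy j : j != x -> j != y -> u^`M(x)^`M(j) = 0.
  by move=> jx jy; rewrite mderiv_comm mderiv_u // mderiv0.
have uy_xy j : j != x -> j != y -> u^`M(y)^`M(j) = 0.
  by move=> jx jy; rewrite mderiv_comm mderiv_u // mderiv0.
exists N; split.
- by rewrite NE; apply: EG_comp.
- by rewrite comp_N ?Nx //; apply: mderiv_u.
- move=> i l lx ly; rewrite mderivB mderivU; have [i1|] := boolP (1 < i)%N.
    by rewrite Ni // mderivD mderivU a_xy // addr0 subrr.
  have [N0xl N0yl] := N0_xy l lx ly.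
  rewrite gt1_ord negb_and !negbK => /orP[] /eqP ->.
    by rewrite Nx N0xl eq_sym (negPf lx) mpolyC0 subr0.
  by rewrite Ny N0yl eq_sym (negPf ly) mpolyC0 subr0.
- move=> i iM; rewrite Ni; last exact: leq_ltn_trans iM.
  by rewrite (aP i).1 ?addr0 // [(i <= M)%N]leqNgt iM andbF.
move=> i iM; have [i1|] := boolP (1 < i)%N.
  have i1M : (1 < i <= M)%N by rewrite i1.
  rewrite Ni // mderivD mderivU ((aP i).2 i1M).1 comp_N // => j.
  exact: Hy_xy.
rewrite gt1_ord negb_and !negbK => /orP[] /eqP ->.
  by rewrite (negPf xy) mpolyC0 sub0r Nx N0x_y -(comp_N _ uy_xy) -vE.
by rewrite eqxx mpolyC1 Ny N0y_y -vE val_y e1 comp_mpolyN opprK (comp_N _ ux_xy).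
Qed.

(** The remainder c i of the i-th component of F o N involves only x, y and
    x_(i+1); for i <= M it does not involve y, by the chain rule, and c_M does not
    involve x_(M+1).  Ordering the variables as x_(M+1), ..., x_(n+1), then
    y, x_2, ..., x_M, then x makes F o N triangular. *)
Lemma chain_map_elementary : elementary_group (polymap_add (polymap_id k n.+2) H).
Proof.
have [e1 eS eE] := chain_relations; have /andP[M0 Mn] := M_bounds.
have [N [EN uN N_xy N_end N_y]] := straightening_map.
have xy := x_neq_y; have yx : y != x by rewrite eq_sym.
have vE (i : 'I_n.+2) : v i = tnth H i by rewrite /v inord_val.
apply: (elementary_group_factor EN).
pose c i := tnth N i - 'X_i + (tnth H i \mPo N).
have -> : polymap_comp (polymap_add (polymap_id k n.+2) H) N =
    [tuple 'X_i + c i | i < n.+2].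
  apply: eq_from_tnth => i; rewrite !tnth_mktuple comp_mpolyD comp_mpolyX_tnth.
  by rewrite /c addrA addrCA subrr addr0.
have N_xy' j l : l != x -> l != y -> j != l -> (tnth N j)^`M(l) = 0.
  move=> lx ly jl; have := N_xy j l lx ly; rewrite mderivB mderivU (negPf jl).
  by rewrite mpolyC0 subr0.
have c_x : c x = 0.
  by rewrite /c -vE -/u uN; ring.
have c_xy (i l : 'I_n.+2) : l != x -> l != y -> (c i)^`M(l) != 0 ->
    (l == i.+1 :> nat) && (i != M :> nat).
  move=> lx ly; rewrite /c mderivD N_xy // add0r mderiv_comp => c0.
  have [j] : exists j : 'I_n.+2, ((tnth H i)^`M(j) \mPo N) * (tnth N j)^`M(l) != 0.
    apply/existsP; apply: contraR c0; rewrite negb_exists => /forallP H0.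
    by rewrite big1 // => j _; apply/eqP; rewrite -[_ == _]negbK H0.
  have [->|jl] := eqVneq j l; last by rewrite N_xy' // mulr0 eqxx.
  rewrite mulf_eq0 negb_or => /andP[Hl _].
  have il : l = i.+1 :> nat.
    apply/eqP; rewrite eq_sym; apply: contraNT Hl => il.
    by rewrite H_shape ?comp_mpoly0 // gt1_ord lx.
  rewrite il eqxx /=; apply: contraNneq Hl => iM.
  have <- : inord i.+1 = l by apply: val_inj; rewrite /= inordK // -il.
  rewrite -vE -/(d i) iM d_end ?comp_mpoly0 // -iM.
  by have := ltn_ord l; rewrite il.
have c_y (i : 'I_n.+2) : i != x -> (i <= M)%N -> (c i)^`M(y) = 0.
  move=> ix iM; have i0 : (0 < i)%N by rewrite lt0n.
  have rest : \sum_(j | (j != x) && (j != y))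
      ((tnth H i)^`M(j) \mPo N) * (tnth N j)^`M(y)
    = - ((u^`M(x) * (tnth H i)^`M(y) - u^`M(y) * (tnth H i)^`M(x)) \mPo N).
    have [iMlt|iMge] := ltnP i M; last first.
      have iME : i = M :> nat by apply/eqP; rewrite eqn_leq iM.
      rewrite -(vE i) iME eE comp_mpoly0 oppr0 big1 // => j jxy.
      have [ij|ij] := eqVneq i.+1 j; last first.
        by rewrite mderiv_v ?comp_mpoly0 ?mul0r ?gt1_ord // -iME.
      have iMn : (M < n.+1)%N by rewrite -iME -ltnS ij.
      have -> : j = inord M.+1 by apply: val_inj; rewrite /= inordK // -iME ij.
      by rewrite -/(d M) d_end // comp_mpoly0 mul0r.
    have i2 : (i.+1 < n.+2)%N by rewrite ltnS (leq_trans iMlt).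
    have i1_gt1 : (1 < (inord i.+1 : 'I_n.+2))%N by rewrite inordK.
    rewrite (bigD1 (inord i.+1)) -?gt1_ord //= big1 ?addr0 => [|j /andP[jxy ij]].
      rewrite N_y ?inordK // -[inord i.+1 == y]negbK.
      have := i1_gt1; rewrite gt1_ord => /andP[_ ->].
      rewrite mpolyC0 sub0r mulrN -rmorphM -(vE i) -eS //.
      by rewrite i0.
    rewrite H_shape ?comp_mpoly0 ?mul0r // ?gt1_ord //.
    by apply: contra ij => /eqP ij; apply/eqP/val_inj; rewrite /= inordK.
  rewrite /c mderivD mderivB mderivU mderiv_comp (bigD1 x) // (bigD1 y) //= rest.
  rewrite !N_y ?val_y // (negPf xy) eqxx mpolyC0 mpolyC1 sub0r -(vE x) -(vE y) val_y e1.
  rewrite comp_mpolyN opprK comp_mpolyB !rmorphM /= -/u.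
  ring.
pose rk (i : 'I_n.+2) := if i == x then (3 * n.+2)%N
  else if (i <= M)%N then (n.+2 + i)%N else nat_of_ord i.
apply: (elementary_group_triangular (rk := rk)) => i j.
have [->|ix] := eqVneq i x; first by rewrite c_x inE msupp0.
apply: contraLR; rewrite -leqNgt => rk_ji.
apply: mderiv_eq0_notin_mvars => //; apply/eqP; apply: contraLR rk_ji => cij.
rewrite -ltnNge /rk (negPf ix).
have lt_i := ltn_ord i.
have [_|jx] := eqVneq j x; first by case: ifP => iM; move: lt_i Mn; lia.
have [jy|jy] := eqVneq j y.
  case: (leqP i M) => [iM|_]; first by move: cij; rewrite jy c_y ?eqxx.
  by rewrite jy val_y M0; lia.
have /andP[/eqP ij iM] := c_xy i j jx jy cij.
case: (leqP i M) => iM'; last by case: ifP => _; lia.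
have -> : (j <= M)%N by rewrite ij ltn_neqAle iM.
by rewrite ij; lia.
Qed.

End ChainMaps.

Theorem theorem3 (k : fieldType) (k_char0 : [pchar k] =i pred0)
    (n : nat) (n_ge3 : (3 <= n)%N) (H : polymap k n)
    (H_first : forall i : 'I_n, i = 0%N :> nat ->
       mvars (tnth H i) \subset [set j : 'I_n | (j < 2)%N])
    (H_middle : forall i : 'I_n, (0 < i < n.-1)%N ->
       mvars (tnth H i) \subset [set j : 'I_n | (j < 2)%N || (j == i.+1 :> nat)])
    (H_last : forall i : 'I_n, i = n.-1 :> nat ->
       mvars (tnth H i) \subset [set j : 'I_n | (j < 2)%N])
    (JH_nilpotent : nilpotent_mx (jacobian H)) :
  elementary_group (polymap_add (polymap_id k n) H).

Proof.
case: n n_ge3 H H_first H_middle H_last JH_nilpotent => [|[|n']] // _ H'.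
move=> H_first H_middle H_last JH; apply: chain_map_elementary => // i j j1 ij.
apply: mderiv_notin_mvars; apply/negP => jH.
have [i0|i0] := posnP i.
  by move/subsetP/(_ j jH): (H_first i i0); rewrite inE ltnNge j1.
have [i_max|i_max] := eqVneq (i : nat) n'.+1.
  by move/subsetP/(_ j jH): (H_last i i_max); rewrite inE ltnNge j1.
have i_mid : (0 < i < n'.+2.-1)%N by rewrite i0 ltn_neqAle i_max -ltnS ltn_ord.
move/subsetP/(_ j jH): (H_middle i i_mid).
by rewrite inE ltnNge j1 eq_sym (negPf ij).
Qed.
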